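(* Let $\alpha>0$, $C>0$, $\sigma>0$. Suppose that $\delta_n$ and $t_n$ satisfy the following assumptions: (A1) the window size satisfies $\delta_n\to\infty$ as $n\to\infty$; (A2) the threshold is set to $\sigma^2+t_n$ with $t_n>0$; (A3) $t_n$ is such that, if $d^2_{\delta_n}(x_{i,j},x_{m,\ell})\ge\frac12$, then $\mathbb{P}(w^S_{i,j}(m,\ell)=1)=o(n^{-1})$ (uniformly over such pairs of pixels); (A4) $\delta_n=O(n^{\beta})$ for some $\beta\le0.3$. Then the risk of the semi-oracle nonlocal means estimator (SNLM) $\hat f^{S}$ over the class $H^{\alpha}(C)$ satisfies $$\inf_{\delta_n,t_n}\ \sup_{f\in H^{\alpha}(C)}R_n(f,\hat f^{S})=\Omega(n^{-1})\qquad(n\to\infty),$$ the infimum being over parameters satisfying (A1)–(A4); that is, for every choice of sequences $(\delta_n),(t_n)$ satisfying (A1)–(A4), $\sup_{f\in H^{\alpha}(C)}R_n(f,\hat f^{S})=\Omega(n^{-1})$.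
   Context: Observation model: for $f$ and $n\ge1$, $\mathrm{Pixel}(i,j)=[\frac in,\frac{i+1}n)\times[\frac jn,\frac{j+1}n)$, $x_{i,j}$ is the average of $f$ over $\mathrm{Pixel}(i,j)$, and one observes $y_{i,j}=x_{i,j}+z_{i,j}$ with $z_{i,j}$ iid $N(0,\sigma^2)$. The image pixels are $S=\{1,\dots,n\}^2$; values at pixels outside $S$ that occur in neighborhoods of boundary pixels are given by the same formulas (with $f_h$ below extended to $\mathbb{R}^2$ by its defining formula). Risk: $R_n(f,\hat f)=\mathbb{E}\big(\frac1{n^2}\sum_i\sum_j (x_{i,j}-\hat f_{i,j})^2\big)$, sums over $S$. Horizon class: $\text{Hölder}^{\alpha}(C)$ is the set of functions $h:\mathbb{R}\to\mathbb{R}$ with $|h^{(k)}(t)-h^{(k)}(t')|\le C|t-t'|^{\alpha-k}$, $k=\lfloor\alpha\rfloor$; for $\alpha=1$ this is read as $|h(t)-h(t')|\le C|t-t'|$. For such $h$, $f_h(t_1,t_2)=\mathbf 1_{\{t_2<h(t_1)\}}$, and $H^{\alpha}(C)=\{f_h: h\in \text{Hölder}^{\alpha}(C)\cap\text{Hölder}^{1}(1)\}$. Neighborhood distances: with integer window size $\delta_n$ and $\rho_n^2=(2\delta_n+1)^2-1$, $$d^2_{\delta_n}(x_{i,j},x_{q,p})=\frac1{\rho_n^2}\Big(\sum_{m=-\delta_n}^{\delta_n}\sum_{\ell=-\delta_n}^{\delta_n}|x_{i+\ell,j+m}-x_{q+\ell,p+m}|^2-|x_{i,j}-x_{q,p}|^2\Big),$$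 and the semi-oracle distance is $$\bar d^2_{\delta_n}(y_{i,j},y_{q,p})=\frac1{\rho_n^2}\Big(\sum_{m=-\delta_n}^{\delta_n}\sum_{\ell=-\delta_n}^{\delta_n}|x_{i+\ell,j+m}-y_{q+\ell,p+m}|^2-(x_{i,j}-y_{q,p})^2\Big).$$ SNLM: $w^S_{i,j}(m,\ell)=1$ if $\bar d^2_{\delta_n}(y_{i,j},y_{m,\ell})\le\sigma^2+t_n$ and $0$ otherwise, and $$\hat f^{S}_{i,j}=\frac{\sum_{(m,\ell)\in S}w^S_{i,j}(m,\ell)\,y_{m,\ell}}{\sum_{(m,\ell)\in S}w^S_{i,j}(m,\ell)},$$ with the convention $0/0=0$. $a(n)=\Omega(b(n))$ means there are $c>0$ and $n_0$ with $|a(n)|\ge c|b(n)|$ for $n>n_0$; $O$ and $o$ have their usual meaning. *)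

(* Defs.v *)
From HB Require Import structures.
From mathcomp Require Import all_boot all_order all_algebra.
From mathcomp Require Import all_classical all_reals all_analysis.
Import Order.TTheory GRing.Theory Num.Theory.
Import numFieldNormedType.Exports.

Set Implicit Arguments.
Unset Strict Implicit.
Unset Printing Implicit Defensive.

Local Open Scope classical_set_scope.
Local Open Scope ring_scope.

Section images.
Context {R : realType}.

(* The exponent 1 is the only one for which the class is not read through
   the derivative of order [floor alpha]: there it means Lipschitz. *)
Definition holder (alpha C : R) : set (R -> R) :=
  [set h | if alpha == 1 then
      forall t t', `|h t - h t'| <= C * `|t - t'|
    else
      (forall k, (k < Num.truncn alpha)%N -> forall t, derivable (derive1n k h) t 1)
      /\ (forall t t', `|derive1n (Num.truncn alpha) h t - derive1n (Num.truncn alpha) h t'|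
                       <= C * `|t - t'| `^ (alpha - (Num.truncn alpha)%:R))].

Definition hypograph_image (h : R -> R) : R * R -> R :=
  fun u => (u.2 < h u.1)%R%:R.

Definition horizon_class (alpha C : R) : set (R * R -> R) :=
  [set hypograph_image h | h in holder alpha C `&` holder 1 1].

(* Indices are integers because windows around boundary pixels leave the
   image {1, ..., n}^2. *)
Definition pixel (n : nat) (i j : int) : set (R * R) :=
  `[i%:~R / n%:R, (i + 1)%:~R / n%:R[ `*` `[j%:~R / n%:R, (j + 1)%:~R / n%:R[.

(* A pixel has area n^-2. *)
Definition pixel_avg (f : R * R -> R) (n : nat) (i j : int) : R :=
  n%:R ^+ 2 *
  \int[(lebesgue_measure \x lebesgue_measure)%E]_(u in pixel n i j) f u.

(* Squared distance between the punctured windows of half-width delta around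
   pixel (i, j) of u and pixel (q, p) of v; the offsets l - delta and
   m - delta run through -delta, ..., delta. *)
Definition nbhd_dist2 (delta : nat) (u v : int -> int -> R) (i j q p : int) : R :=
  ((2 * delta + 1) ^ 2 - 1)%:R^-1 *
  (\sum_(m < 2 * delta + 1) \sum_(l < 2 * delta + 1)
     `|u (i + (l%:Z - delta%:Z)) (j + (m%:Z - delta%:Z))
       - v (q + (l%:Z - delta%:Z)) (p + (m%:Z - delta%:Z))| ^+ 2
   - `|u i j - v q p| ^+ 2).

Definition snlm_weight (sigma t : R) (delta : nat) (x y : int -> int -> R)
    (i j m l : int) : R :=
  (nbhd_dist2 delta x y i j m l <= sigma ^+ 2 + t)%R%:R.

(* Since 0^-1 = 0, the estimate is 0 when all the weights vanish. *)
Definition snlm (sigma t : R) (delta n : nat) (x y : int -> int -> R)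
    (i j : int) : R :=
  (\sum_(1 <= m < n.+1) \sum_(1 <= l < n.+1)
     snlm_weight sigma t delta x y i j m%:Z l%:Z * y m%:Z l%:Z) /
  (\sum_(1 <= m < n.+1) \sum_(1 <= l < n.+1)
     snlm_weight sigma t delta x y i j m%:Z l%:Z).

End images.

Section model.
Context {R : realType} {d : measure_display} {T : measurableType d}.
Variable P : probability T R.

Definition mutually_independent (I : choiceType) (X : I -> {RV P >-> R}) :=
  forall (s : seq I) (B : I -> set R),
    uniq s -> (forall k, measurable (B k)) ->
    P (\bigcap_(k in [set` s]) (X k @^-1` B k)) =
    (\prod_(k <- s) P (X k @^-1` B k))%E.

(* The second parameter of [normal_prob] is the standard deviation. *)
Definition iid_gaussian (I : choiceType) (sigma : R) (X : I -> {RV P >-> R}) :=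
  mutually_independent X /\
  forall k (B : set R), measurable B ->
    distribution P (X k) B = normal_prob 0 sigma B.

Definition observation (f : R * R -> R) (n : nat)
    (z : int * int -> {RV P >-> R}) (w : T) (i j : int) : R :=
  pixel_avg f n i j + z (i, j) w.

Definition snlm_risk (sigma t : R) (delta n : nat)
    (z : int * int -> {RV P >-> R}) (f : R * R -> R) : \bar R :=
  'E_P[fun w => n%:R ^- 2 *
    \sum_(1 <= i < n.+1) \sum_(1 <= j < n.+1)
      (pixel_avg f n i%:Z j%:Z
       - snlm sigma t delta n (pixel_avg f n) (observation f n z w)
           i%:Z j%:Z) ^+ 2].

End model.

(* Extended-real version of a = Omega(b), so that it applies to a supremum
   without first knowing that it is finite. *)
Definition ereal_bigOmega {R : realType} (a : nat -> \bar R) (b : nat -> R) :=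
  exists2 c : R, 0 < c &
    exists n0 : nat, forall n, (n0 < n)%N -> ((c * `|b n|)%:E <= `|a n|)%E.

(* Main.v *)
Require Import Defs.
From HB Require Import structures.
From mathcomp Require Import all_boot all_order all_algebra.
From mathcomp Require Import zify ring lra.
From mathcomp Require Import all_classical all_reals all_analysis.
From mathcomp Require Import measurable_realfun.
Import Order.TTheory GRing.Theory Num.Theory.
Import numFieldNormedType.Exports.

(* Take [h = 1]. Every pixel of the image is then white, except those of row
   [n], which are black. The semi-oracle weights attached to a pixel of row [n]
   do not depend on its column, so a single random mean [v] estimates the whole
   row, and the risk is at least [E v^2 / n]; it remains to keep [v] away
   from 0.
   - Row [n - 1] is white, but its windows differ from those of row [n] on one
     row only. This moves the squared distance by a constant number of standard
     deviations, so each of its pixels is kept with probability at least some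
     [c > 0] independent of [n]. Weights with disjoint windows are independent,
     hence by Chebyshev at least [c n / 2] white pixels are kept, against at
     most [n] black ones.
   - The noise [w z] of distinct pixels is uncorrelated as soon as one lies
     outside the window of the other, so the noise of the rows at distance at
     most [delta] has variance [O(n delta^3) = o(n^2)]; this uses (A4).
   - Every pixel of a lower row is at squared distance at least 1/2, so by (A3)
     the expected noise of these at most [n^2] pixels is [n^2 o(1 / n)].
   With probability at least 1/2 the mean [v] therefore exceeds
   [c / (2 (c + 2))]. *)

Set Implicit Arguments.
Unset Strict Implicit.
Unset Printing Implicit Defensive.

Local Open Scope classical_set_scope.
Local Open Scope ring_scope.

(** * Independence of disjoint blocks of random variables *)

Section block_independence.
Context {R : realType} {d : measure_display} {T : measurableType d}.
Context (P : probability T R).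

(** Dynkin's pi-lambda theorem: the events independent of a fixed [B] are closed under complements
    and countable disjoint unions, so independence of [B] passes from the pi-system [G] to the
    sigma-algebra it generates. *)
Lemma indep_g_sigma_algebra (G : set (set T)) (B : set T) :
  setI_closed G -> G `<=` measurable -> measurable B ->
  (forall A, G A -> P (A `&` B) = (P A * P B)%E) ->
  forall A, <<s G >> A -> P (A `&` B) = (P A * P B)%E.
Proof.
move=> GI Gm mB GB.
have sGm : <<s G >> `<=` measurable.
  by apply: smallest_sub => //; exact: sigma_algebra_measurable.
apply: (@dynkin_induction _ (g_sigma_algebraType G) G
   (fun A => P (A `&` B) = (P A * P B)%E)) => //.
- by rewrite setTI probability_setT mul1e.
- move=> S /sGm mS PS.
  have PBfin : P B \is a fin_num by exact: fin_num_measure.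
  have PSfin : P S \is a fin_num by exact: fin_num_measure.
  rewrite setIC -setDE measureD// ?ltey_eq ?PBfin//.
  rewrite probability_setC// muleBl// mul1e -PS setIC //.
- move=> F mF tF PF.
  have mF' n : @measurable d T (F n) by apply: sGm; exact: mF.
  rewrite setI_bigcupl measure_bigcup//; last 2 first.
  + by move=> n _; exact: measurableI.
  + exact: trivIset_setIr.
  have PBfin : P B \is a fin_num by exact: fin_num_measure.
  rewrite measure_bigcup// [RHS]muleC -(fineK PBfin) -nneseriesZl//.
  by apply: eq_eseriesr => n _; rewrite fineK// muleC; exact: PF.
Qed.

Context {I : choiceType} (X : I -> {RV P >-> R}).

(** A pi-system generating the sigma-algebra of the variables [X k] with [k] in [s]; a coordinate is
    left free by taking [B k] to be the whole line. *)
Definition cylinders (s : seq I) : set (set T) :=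
  [set A | exists2 B : I -> set R, (forall k, measurable (B k)) &
             A = \bigcap_(k in [set` s]) (X k @^-1` B k)].

(** The usual rendering of the fact that [f] depends only on the variables [X k] with [k] in [s]. *)
Definition sigma_measurable (s : seq I) (f : T -> R) :=
  measurable_fun [set: g_sigma_algebraType (cylinders s)] f.

Lemma cylinders_setI s : setI_closed (cylinders s).
Proof.
move=> _ _ [B mB ->] [C mC ->]; exists (fun k => B k `&` C k).
  by move=> k; exact: measurableI.
by rewrite -bigcapI.
Qed.

Lemma cylinders_sub s s' : {subset s <= s'} -> cylinders s `<=` cylinders s'.
Proof.
move=> ss' _ [B mB ->]; exists (fun k => if k \in s then B k else setT).
  by move=> k; case: ifP.
apply/seteqP; split=> t /= Bt k /=.
  by case: ifP => // ks _; exact: Bt.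
by move=> ks; have := Bt k (ss' _ ks); rewrite /= ks.
Qed.

Lemma cylinders_measurable s : cylinders s `<=` measurable.
Proof.
move=> _ [B mB ->]; rewrite bigcap_seq.
elim/big_ind : _ => //; first by move=> *; exact: measurableI.
by move=> k _; rewrite -[_ @^-1` _]setTI; exact: measurable_funP.
Qed.

Lemma sigma_cylinders_measurable s : <<s cylinders s >> `<=` measurable.
Proof.
apply: smallest_sub; first exact: sigma_algebra_measurable.
exact: cylinders_measurable.
Qed.

Lemma sigma_measurable_preimage s f B : sigma_measurable s f ->
  measurable B -> <<s cylinders s >> (f @^-1` B).
Proof. by move=> mf mB; have := mf measurableT B mB; rewrite setTI. Qed.

Lemma sigma_measurableW s f : sigma_measurable s f -> measurable_fun setT f.
Proof.
move=> mf _ B mB; rewrite setTI; apply: sigma_cylinders_measurable.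
exact: (sigma_measurable_preimage mf mB).
Qed.

Lemma sigma_measurable_sub s s' f : {subset s <= s'} ->
  sigma_measurable s f -> sigma_measurable s' f.
Proof.
move=> ss' mf _ B mB; rewrite setTI.
apply: (sub_sigma_algebra2 (cylinders_sub ss')).
exact: (sigma_measurable_preimage mf mB).
Qed.

Lemma sigma_measurable_coord s k : k \in s -> sigma_measurable s (X k).
Proof.
move=> ks _ B mB; rewrite setTI; apply: sub_sigma_algebra.
exists (fun j => if j == k then B else setT); first by move=> j; case: ifP.
apply/seteqP; split=> t /=; first by move=> Bt j _; case: eqP => // ->.
by move=> /(_ k ks) /=; rewrite eqxx.
Qed.

Hypothesis Xindep : mutually_independent X.

Lemma cylinders_indep s1 s2 A B : uniq (s1 ++ s2) ->
  cylinders s1 A -> cylinders s2 B -> P (A `&` B) = (P A * P B)%E.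
Proof.
move=> us [A' mA ->] [B' mB ->].
(* As [s1] and [s2] are disjoint, a single family [C] describes both events, and the product formula
   over [s1 ++ s2] splits. *)
pose C k := if k \in s1 then A' k else B' k.
have mC k : measurable (C k) by rewrite /C; case: ifP.
have Hs1 : \bigcap_(k in [set` s1]) (X k @^-1` A' k) =
           \bigcap_(k in [set` s1]) (X k @^-1` C k).
  by apply: eq_bigcapr => k /= ks; rewrite /C ks.
have Hs2 : \bigcap_(k in [set` s2]) (X k @^-1` B' k) =
           \bigcap_(k in [set` s2]) (X k @^-1` C k).
  apply: eq_bigcapr => k /= ks; rewrite /C ifF//.
  by move: us; rewrite cat_uniq => /and3P[_ /hasPn /(_ _ ks)/negbTE].
have [us1 us2] : uniq s1 /\ uniq s2.
  by move: us; rewrite cat_uniq => /and3P[].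
rewrite Hs1 Hs2 -bigcap_setU.
have -> : [set` s1] `|` [set` s2] = [set` s1 ++ s2].
  by apply/seteqP; split=> k /=; rewrite mem_cat => /orP.
by rewrite !Xindep// big_cat.
Qed.

(** The pi-lambda argument runs twice: with [B] fixed it extends the left event beyond cylinders,
    and with a left cylinder fixed it extends the right one. *)
Lemma block_indep s1 s2 A B : uniq (s1 ++ s2) ->
  <<s cylinders s1 >> A -> <<s cylinders s2 >> B ->
  P (A `&` B) = (P A * P B)%E.
Proof.
move=> us sA sB.
apply: (@indep_g_sigma_algebra (cylinders s1)) => //.
- exact: cylinders_setI.
- exact: cylinders_measurable.
- exact: sigma_cylinders_measurable sB.
move=> A' cA'; rewrite setIC muleC.
apply: (@indep_g_sigma_algebra (cylinders s2)) => //.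
- exact: cylinders_setI.
- exact: cylinders_measurable.
- exact: cylinders_measurable cA'.
by move=> B' cB'; rewrite setIC muleC (@cylinders_indep s1 s2).
Qed.

Section product.
Variables (s1 s2 : seq I) (f g : T -> R).
Hypotheses (us : uniq (s1 ++ s2)) (mf : sigma_measurable s1 f)
  (mg : sigma_measurable s2 g).

(** A product measure is determined by its values on rectangles, where [block_indep] gives the
    product formula. *)
Lemma indep_joint_law (A : set (R * R)) : measurable A ->
  (pushforward P f \x pushforward P g)%E A =
  pushforward P (fun t => (f t, g t)) A.
Proof.
move=> mA.
have mf' := sigma_measurableW mf.
have mg' := sigma_measurableW mg.
pose F : {mfun T >-> R} := HB.pack f (isMeasurableFun.Build _ _ _ _ _ mf').
pose G : {mfun T >-> R} := HB.pack g (isMeasurableFun.Build _ _ _ _ _ mg').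
have mfg : measurable_fun setT (fun t => (f t, g t)).
  exact: measurable_fun_pair.
pose FG : {mfun T >-> (R * R)%type} :=
  HB.pack (fun t => (f t, g t)) (isMeasurableFun.Build _ _ _ _ _ mfg).
apply: (@product_measure_unique _ _ _ _ R (distribution P F)
  (distribution P G) (distribution P FG)) => // U V mU mV.
rewrite /distribution /pushforward /=.
rewrite -(@block_indep s1 s2)//; exact: sigma_measurable_preimage.
Qed.

Lemma indep_ge0_integralM : (forall t, 0 <= f t) -> (forall t, 0 <= g t) ->
  (\int[P]_t (f t * g t)%:E = \int[P]_t (f t)%:E * \int[P]_t (g t)%:E)%E.
Proof.
move=> f0 g0.
have mf' := sigma_measurableW mf.
have mg' := sigma_measurableW mg.
pose F : {mfun T >-> R} := HB.pack f (isMeasurableFun.Build _ _ _ _ _ mf').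
pose G : {mfun T >-> R} := HB.pack g (isMeasurableFun.Build _ _ _ _ _ mg').
have mfg : measurable_fun setT (fun t => (f t, g t)).
  exact: measurable_fun_pair.
(* Tonelli's theorem will be applied to the joint law. The absolute values make the integrand
   nonnegative on the whole plane and change nothing on the values taken by [f] and [g]. *)
pose h (z : R * R) := (`|z.1|%:E * `|z.2|%:E)%E.
have mh : measurable_fun setT h.
  by apply: emeasurable_funM; apply/measurable_EFinP; exact: (measurableT_comp (@normr_measurable R setT)).
have h0 z : (0 <= h z)%E by rewrite mule_ge0// lee_fin.
transitivity (\int[P]_t (h \o (fun t => (f t, g t))) t)%E.
  by apply: eq_integral => t _; rewrite /h/= !ger0_norm.
rewrite -[setT in LHS](preimage_setT (fun t => (f t, g t))).
rewrite -(ge0_integral_pushforward mfg)//.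
transitivity (\int[(distribution P F \x distribution P G)%E]_z h z)%E.
  apply: eq_measure_integral => A mA _; apply/esym.
  exact: indep_joint_law.
rewrite (fubini_tonelli1 (m1 := distribution P F) (m2 := distribution P G))//.
rewrite /fubini_F/=.
have mn : measurable_fun setT (fun x : R => `|x|%:E).
  by apply/measurable_EFinP; apply: (measurableT_comp (@normr_measurable R setT)).
have -> : (\int[P]_t (g t)%:E = \int[distribution P G]_y (`|y|%:E))%E.
  rewrite ge0_integral_distribution//.
  by apply: eq_integral => t _; rewrite /= ger0_norm.
under eq_integral => x _.
  rewrite /h/= ge0_integralZl_EFin//.
  over.
rewrite ge0_integralZr//; last by apply: integral_ge0 => ? _; rewrite lee_fin.
congr (_ * _)%E.
rewrite ge0_integral_distribution//.
by apply: eq_integral => t _; rewrite /= ger0_norm.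
Qed.

End product.

Lemma indep_integrableM s1 s2 (f g : T -> R) : uniq (s1 ++ s2) ->
  sigma_measurable s1 f -> sigma_measurable s2 g ->
  P.-integrable setT (EFin \o f) -> P.-integrable setT (EFin \o g) ->
  P.-integrable setT (fun t => (f t * g t)%:E).
Proof.
move=> us mf mg /integrableP[_ fi] /integrableP[_ gi].
apply/integrableP; split.
  apply/measurable_EFinP; apply: measurable_funM.
    exact: (sigma_measurableW mf).
  exact: (sigma_measurableW mg).
rewrite (eq_integral (fun t => (`|f t| * `|g t|)%:E)); last first.
  by move=> t _; rewrite abse_EFin normrM.
rewrite (@indep_ge0_integralM s1 s2)//; [|exact: (measurableT_comp (@normr_measurable R setT))..].
by rewrite lte_mul_pinfty ?integral_ge0// ge0_fin_numE ?integral_ge0.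
Qed.

Lemma indep_RintegralM s1 s2 (f g : T -> R) : uniq (s1 ++ s2) ->
  sigma_measurable s1 f -> sigma_measurable s2 g ->
  P.-integrable setT (EFin \o f) -> P.-integrable setT (EFin \o g) ->
  \int[P]_t (f t * g t) = (\int[P]_t f t) * (\int[P]_t g t).
Proof.
move=> us mf mg fi gi.
(* The parts [(|h| + h) / 2] and [(|h| - h) / 2] stay measurable with respect to the block, which
   reduces the claim to nonnegative factors. *)
have pos (s : seq I) (h : T -> R) : sigma_measurable s h ->
    P.-integrable setT (EFin \o h) -> exists hp hm : T -> R,
    [/\ forall t, h t = hp t - hm t, (forall t, 0 <= hp t) /\ (forall t, 0 <= hm t),
     sigma_measurable s hp /\ sigma_measurable s hm,
     P.-integrable setT (EFin \o hp) & P.-integrable setT (EFin \o hm)].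
  move=> mh hi.
  have mn : sigma_measurable s (fun t => `|h t|) by exact: (measurableT_comp (@normr_measurable R setT)).
  have ni : P.-integrable setT (fun t => `|h t|%:E) by exact: integrable_norm.
  exists (fun t => 2^-1 * (`|h t| + h t)), (fun t => 2^-1 * (`|h t| - h t)).
  split.
  - by move=> t; field.
  - split=> t; rewrite mulr_ge0//.
      by rewrite -lerBlDr sub0r; have := ler_norm (- h t); rewrite normrN.
    by rewrite subr_ge0 ler_norm.
  - split; apply: measurable_funM => //; first exact: measurable_funD.
    exact: measurable_funB.
  - rewrite (_ : _ \o _ = (fun t => (2^-1)%:E * (`|h t|%:E + (h t)%:E))%E)//.
    by apply: integrableZl => //; exact: integrableD.
  - rewrite (_ : _ \o _ = (fun t => (2^-1)%:E * (`|h t|%:E - (h t)%:E))%E)//.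
    by apply: integrableZl => //; exact: integrableB.
have posM (hp kp : T -> R) :
    sigma_measurable s1 hp -> sigma_measurable s2 kp ->
    (forall t, 0 <= hp t) -> (forall t, 0 <= kp t) ->
    P.-integrable setT (EFin \o hp) -> P.-integrable setT (EFin \o kp) ->
    \int[P]_t (hp t * kp t) = (\int[P]_t hp t) * (\int[P]_t kp t).
  move=> mh mk h0 k0 hi ki.
  rewrite /Rintegral (@indep_ge0_integralM s1 s2)// fineM//;
    exact: integrable_fin_num.
have [fp [fm [fE [fp0 fm0] [mfp mfm] fpi fmi]]] := pos _ _ mf fi.
have [gp [gm [gE [gp0 gm0] [mgp mgm] gpi gmi]]] := pos _ _ mg gi.
have fE' : \int[P]_t f t = \int[P]_t fp t - \int[P]_t fm t.
  by rewrite -RintegralB//; apply: eq_Rintegral => t _; rewrite fE.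
have gE' : \int[P]_t g t = \int[P]_t gp t - \int[P]_t gm t.
  by rewrite -RintegralB//; apply: eq_Rintegral => t _; rewrite gE.
have i11 := indep_integrableM us mfp mgp fpi gpi.
have i12 := indep_integrableM us mfp mgm fpi gmi.
have i21 := indep_integrableM us mfm mgp fmi gpi.
have i22 := indep_integrableM us mfm mgm fmi gmi.
rewrite (@eq_Rintegral _ _ _ _ _ (fun t =>
    (fp t * gp t + fm t * gm t) - (fp t * gm t + fm t * gp t))); last first.
  by move=> t _; rewrite fE gE; ring.
rewrite RintegralB//; last 2 first.
  exact: (integrableD measurableT i11 i22).
  exact: (integrableD measurableT i12 i21).
rewrite !RintegralD// !posM// fE' gE'; ring.
Qed.

End block_independence.

Lemma integral_cst_probability {R : realType} {d : measure_display}
    {T : measurableType d} (P : probability T R) (c : R) :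
  (\int[P]_t c%:E = c%:E)%E.
Proof.
rewrite integral_cst//; apply: etrans (mule1 _).
by congr (_ * _)%E; exact: probability_setT.
Qed.

Section independent_products.
Context {R : realType} {d : measure_display} {T : measurableType d}.
Context (P : probability T R) {I : choiceType} (X : I -> {RV P >-> R}).

Lemma sigma_measurable_sum_coord (s : seq I) (g : I -> R -> R) :
  (forall k, measurable_fun setT (g k)) ->
  sigma_measurable X s (fun t => \sum_(k <- s) g k (X k t)).
Proof.
move=> mg; elim: s => [|k s IHs].
  under [X in sigma_measurable _ _ X]eq_fun do rewrite big_nil.
  exact: measurable_cst.
under [X in sigma_measurable _ _ X]eq_fun do rewrite big_cons.
apply: measurable_funD.
  apply: (measurableT_comp (mg k)); apply: sigma_measurable_coord.
  exact: mem_head.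
by apply: sigma_measurable_sub IHs => j js; rewrite inE js orbT.
Qed.

Lemma sigma_measurable_sum_sqr_dist (s : seq I) (a : I -> R) :
  sigma_measurable X s (fun t => \sum_(k <- s) (a k - X k t) ^+ 2).
Proof.
apply: (@sigma_measurable_sum_coord s (fun k x => (a k - x) ^+ 2)) => k.
by apply: measurable_funX; exact: measurable_funB.
Qed.

Lemma sigma_measurable_prod_coord (s : seq I) (g : I -> R -> R) :
  (forall k, measurable_fun setT (g k)) ->
  sigma_measurable X s (fun t => \prod_(k <- s) g k (X k t)).
Proof.
move=> mg; elim: s => [|k s IHs].
  under [X in sigma_measurable _ _ X]eq_fun do rewrite big_nil.
  exact: measurable_cst.
under [X in sigma_measurable _ _ X]eq_fun do rewrite big_cons.
apply: measurable_funM.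
  apply: (measurableT_comp (mg k)); apply: sigma_measurable_coord.
  exact: mem_head.
by apply: sigma_measurable_sub IHs => j js; rewrite inE js orbT.
Qed.

Hypothesis Xindep : mutually_independent X.

Lemma indep_integral_prod (s : seq I) (g : I -> R -> R) : uniq s ->
  (forall k, measurable_fun setT (g k)) -> (forall k x, 0 <= g k x) ->
  (\int[P]_t (\prod_(k <- s) g k (X k t))%:E =
   \prod_(k <- s) \int[P]_t (g k (X k t))%:E)%E.
Proof.
move=> us mg g0; elim: s us => [_|k s IHs us].
  under eq_integral do rewrite big_nil.
  by rewrite big_nil integral_cst_probability.
under eq_integral do rewrite big_cons.
rewrite big_cons -IHs; last by move: us => /andP[].
rewrite (@indep_ge0_integralM _ _ _ _ _ X Xindep [:: k] s)//.
- apply: (measurableT_comp (mg k)); apply: sigma_measurable_coord.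
  exact: mem_head.
- exact: sigma_measurable_prod_coord.
- by move=> t; exact: prodr_ge0.
Qed.

End independent_products.

(** * Gaussian integrals *)

Section gaussian.
Context {R : realType} {d : measure_display} {T : measurableType d}.
Context (P : probability T R) (Z : {RV P >-> R}) (sigma : R).
Hypothesis sigma_gt0 : 0 < sigma.
Hypothesis lawZ : forall B : set R, measurable B ->
  distribution P Z B = normal_prob 0 sigma B.

(** The Radon-Nikodym derivative of the normal law and the explicit density agree only almost
    everywhere, which is enough under the integral. *)
Lemma ge0_integral_gaussian (g : R -> R) : measurable_fun setT g ->
  (forall x, 0 <= g x) ->
  (\int[P]_t (g (Z t))%:E =
   \int[lebesgue_measure]_x (g x * normal_pdf 0 sigma x)%:E)%E.
Proof.
move=> mg g0.
pose nu : probability (measurableTypeR R) R := normal_prob 0 sigma.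
pose mu : {sigma_finite_measure set (measurableTypeR R) -> \bar R} :=
  @lebesgue_measure R.
have numu : nu `<< mu by exact: normal_prob_dominates.
have mZ : measurable_fun setT (Z : T -> measurableTypeR R).
  by move=> mT B mB; exact: (measurable_funP Z mT B mB).
pose Z' : {mfun T >-> measurableTypeR R} :=
  HB.pack (Z : T -> measurableTypeR R) (isMeasurableFun.Build _ _ _ _ _ mZ).
have mg' : measurable_fun [set: measurableTypeR R] g.
  by move=> mT B mB; exact: (mg mT B mB).
have mgE : measurable_fun [set: measurableTypeR R] (EFin \o g).
  exact/measurable_EFinP.
transitivity (\int[distribution P Z']_x (g x)%:E)%E.
  by rewrite ge0_integral_distribution// => x; rewrite lee_fin.
transitivity (\int[nu]_x (g x)%:E)%E.
  by apply: eq_measure_integral => A mA _; exact: lawZ.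
rewrite -(Radon_Nikodym_SigmaFinite.change_of_variables numu)//.
have fi := Radon_Nikodym_SigmaFinite.f_integrable numu.
have pi := integrable_normal_pdf (0 : R) sigma.
have mp := measurable_normal_pdf (0 : R) sigma.
apply: ae_eq_integral => //.
- by apply: emeasurable_funM => //; exact: measurable_int fi.
- by apply/measurable_EFinP; exact: measurable_funM.
have : ae_eq mu setT (Radon_Nikodym_SigmaFinite.f nu mu)
    (fun x => (normal_pdf 0 sigma x)%:E).
  apply: integral_ae_eq => //; first exact/measurable_EFinP.
  by move=> E _ mE; rewrite -Radon_Nikodym_SigmaFinite.f_integral.
apply: filterS => x /(_ Logic.I) fx _.
by rewrite fx EFinM.
Qed.

(** Completing the square: times the density of [Z], the integrand is a constant times the density
    of the normal law of mean [m] and standard deviation [tau]. A negative [l] is allowed as long as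
    [v] stays positive. *)
Lemma gaussian_mgf_quadratic (l th : R) : 0 < 1 + 2 * l * sigma ^+ 2 ->
  (\int[P]_t (expR (- (l * Z t ^+ 2) + th * Z t))%:E =
   ((Num.sqrt (1 + 2 * l * sigma ^+ 2))^-1 *
    expR (th ^+ 2 * sigma ^+ 2 / (2 * (1 + 2 * l * sigma ^+ 2))))%:E)%E.
Proof.
set v := 1 + _ => v0.
have sv0 : 0 < Num.sqrt v by rewrite sqrtr_gt0.
have svE : Num.sqrt v ^+ 2 = v by rewrite sqr_sqrtr// ltW.
pose tau := sigma / Num.sqrt v.
have tau0 : 0 < tau by rewrite divr_gt0.
pose m := th * sigma ^+ 2 / v.
have mq : measurable_fun setT (fun x : R => expR (- (l * x ^+ 2) + th * x)).
  apply: measurableT_comp => //; apply: measurable_funD.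
    by apply: measurable_funN; apply: measurable_funM => //; exact: measurable_funX.
  exact: measurable_funM.
rewrite (@ge0_integral_gaussian (fun x => expR (- (l * x ^+ 2) + th * x)))//.
rewrite (eq_integral (fun x : measurableTypeR R => ((Num.sqrt v)^-1 *
    expR (th ^+ 2 * sigma ^+ 2 / (2 * v)))%:E * (normal_pdf m tau x)%:E)%E).
  rewrite ge0_integralZl_EFin//.
  - by rewrite integral_normal_pdf mule1.
  - by move=> x _; rewrite lee_fin normal_pdf_ge0.
  - by apply/measurable_EFinP; exact: measurable_normal_pdf.
move=> x _; rewrite -EFinM; congr (_%:E).
rewrite !normal_pdfE ?gt_eqF//.
have -> : normal_peak tau = Num.sqrt v * normal_peak sigma.
  rewrite /normal_peak.
  have -> : sigma ^+ 2 * pi *+ 2 = v * (tau ^+ 2 * pi *+ 2).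
    rewrite mulrnAr mulrA /tau expr_div_n svE mulrCA divff ?mulr1//.
    by rewrite gt_eqF.
  by rewrite sqrtrM ?(ltW v0)// invfM mulrA divff ?mul1r// gt_eqF.
rewrite /normal_fun.
have cancel_sqrt (p E F : R) :
    (Num.sqrt v)^-1 * E * (Num.sqrt v * p * F) = p * (E * F).
  by field; rewrite gt_eqF.
rewrite cancel_sqrt mulrCA; congr (_ * _).
rewrite -!expRD; congr expR.
rewrite /m /tau expr_div_n svE -[sigma ^+ 2 *+ 2]mulr_natr -[_ / v *+ 2]mulr_natr.
have s0 : sigma != 0 by rewrite gt_eqF.
have v0' : v != 0 by rewrite gt_eqF.
rewrite -[in LHS](_ : (v - 1) / (2 * sigma ^+ 2) = l); last by rewrite /v; field.
by field; rewrite s0 v0'.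
Qed.

(** Expanding the square reduces this to the previous formula with [th = 2 * l * a]. *)
Lemma gaussian_expR_sqr_dist (l a : R) : 0 < 1 + 2 * l * sigma ^+ 2 ->
  (\int[P]_t (expR (- (l * (a - Z t) ^+ 2)))%:E =
   ((Num.sqrt (1 + 2 * l * sigma ^+ 2))^-1 *
    expR (- (l * a ^+ 2 / (1 + 2 * l * sigma ^+ 2))))%:E)%E.
Proof.
move=> v0; have v0' : 1 + 2 * l * sigma ^+ 2 != 0 by rewrite gt_eqF.
rewrite (eq_integral (fun t => (expR (- (l * a ^+ 2)))%:E *
    (expR (- (l * Z t ^+ 2) + 2 * l * a * Z t))%:E)%E); last first.
  by move=> t _; rewrite -EFinM -expRD; congr (expR _)%:E; ring.
rewrite ge0_integralZl_EFin//; last first.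
  apply/measurable_EFinP; apply: measurableT_comp => //.
  apply: measurable_funD; last exact: measurable_funM.
  by apply: measurable_funN; apply: measurable_funM => //; exact: measurable_funX.
rewrite gaussian_mgf_quadratic// -EFinM mulrCA -expRD.
by congr (_ * expR _)%:E; field.
Qed.

(** The inequality [x <= exp x] at [x ^+ 2 / (4 * sigma ^+ 2)], in the shape of
    [gaussian_mgf_quadratic] with [th = 0]. The rate is half the critical one, so the exponential
    moment is finite. *)
Let le_sqr_expR (x : R) : x ^+ 2 <=
  4 * sigma ^+ 2 * expR (- (- (4 * sigma ^+ 2)^-1 * x ^+ 2) + 0 * x).
Proof.
have s20 : 0 < 4 * sigma ^+ 2 by rewrite mulr_gt0// exprn_gt0.
rewrite -ler_pdivrMl//; apply: le_trans (expR_ge1Dx _).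
by rewrite mul0r addr0 mulNr opprK lerDr.
Qed.

Lemma gaussian_integral_sqr_le :
  (\int[P]_t (Z t ^+ 2)%:E <= (8 * sigma ^+ 2)%:E)%E.
Proof.
have s20 : 0 < 4 * sigma ^+ 2 by rewrite mulr_gt0// exprn_gt0.
have s0 : sigma != 0 by rewrite gt_eqF.
have vE : 1 + 2 * (- (4 * sigma ^+ 2)^-1) * sigma ^+ 2 = 2^-1 by field.
apply: (@le_trans _ _ (\int[P]_t ((4 * sigma ^+ 2)%:E *
    (expR (- (- (4 * sigma ^+ 2)^-1 * Z t ^+ 2) + 0 * Z t))%:E))%E).
  apply: ge0_le_integral => //.
  - by move=> t _; rewrite lee_fin sqr_ge0.
  - by apply/measurable_EFinP; exact: measurable_funX.
  - apply/measurable_EFinP; apply: measurable_funM => //.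
    apply: measurableT_comp => //.
    apply: measurable_funD; last exact: measurable_funM.
    by apply: measurable_funN; apply: measurable_funM => //; exact: measurable_funX.
  - by move=> t _; rewrite -EFinM lee_fin; exact: le_sqr_expR.
rewrite ge0_integralZl_EFin//; last 2 first.
- apply/measurable_EFinP; apply: measurableT_comp => //.
  apply: measurable_funD; last exact: measurable_funM.
  by apply: measurable_funN; apply: measurable_funM => //; exact: measurable_funX.
- exact: ltW.
rewrite gaussian_mgf_quadratic vE ?invr_gt0// -EFinM lee_fin.
rewrite expr0n/= mul0r mul0r expR0 mulr1.
have h : 2^-1 <= Num.sqrt (2^-1 : R).
  by rewrite -ler_sqr ?nnegrE ?sqrtr_ge0// sqr_sqrtr//; lra.
have : (Num.sqrt (2^-1 : R))^-1 <= 2 by rewrite -[leRHS]invrK lef_pV2 ?posrE ?sqrtr_gt0.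
by move=> h2; apply: (le_trans (ler_wpM2l (ltW s20) h2)); rewrite mulrAC -natrM.
Qed.

Lemma gaussian_integral_abs_le :
  (\int[P]_t `|Z t|%:E <= (1 + 8 * sigma ^+ 2)%:E)%E.
Proof.
apply: (@le_trans _ _ (\int[P]_t (1%:E + (Z t ^+ 2)%:E))%E).
  apply: ge0_le_integral => //.
  - by apply/measurable_EFinP; apply: (measurableT_comp (@normr_measurable R setT)).
  - by apply/measurable_EFinP; apply: measurable_funD => //; exact: measurable_funX.
  - move=> t _; rewrite -EFinD lee_fin -[in leRHS]real_normK ?num_real//.
    by nra.
rewrite ge0_integralD//; last 2 first.
- by move=> t _; rewrite lee_fin sqr_ge0.
- by apply/measurable_EFinP; exact: measurable_funX.
by rewrite integral_cst_probability EFinD leeD2l// gaussian_integral_sqr_le.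
Qed.

Lemma gaussian_integrable : P.-integrable setT (EFin \o Z).
Proof.
apply/integrableP; split; first by apply/measurable_EFinP.
apply: le_lt_trans (ltry (1 + 8 * sigma ^+ 2)).
exact: gaussian_integral_abs_le.
Qed.

(* [1 + th z <= exp (th z)] gives [1 + th E z <= exp (th^2 sigma^2 / 2)] for
   every [th], and this forces [E z = 0]. *)
Lemma gaussian_mean0 : \int[P]_t Z t = 0.
Proof.
set m := \int[P]_t Z t.
have key (th : R) : 1 + th * m <= expR (th ^+ 2 * sigma ^+ 2 / 2).
  have := @gaussian_mgf_quadratic 0 th.
  rewrite mulr0 mul0r addr0 sqrtr1 invr1 mul1r mulr1 => /(_ ltr01) E.
  rewrite -lee_fin -E EFinD EFinM.
  have -> : m%:E = (\int[P]_t (Z t)%:E)%E.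
    by rewrite /m /Rintegral fineK//; exact: integrable_fin_num gaussian_integrable.
  rewrite -integralZl//; last exact: gaussian_integrable.
  rewrite -(integral_cst_probability P 1).
  rewrite -integralD//; last 2 first.
  - exact: (finite_measure_integrable_cst P 1).
  - by apply: integrableZl => //; exact: gaussian_integrable.
  have i1 : P.-integrable setT (fun t => (1 + th%:E * (Z t)%:E)%E).
    apply: integrableD => //; first exact: (finite_measure_integrable_cst P 1).
    by apply: integrableZl => //; exact: gaussian_integrable.
  apply: le_integral => //.
    apply/integrableP; split.
      apply/measurable_EFinP; apply: measurableT_comp => //.
      apply: measurable_funD; last exact: measurable_funM.
      apply: measurable_funN; apply: measurable_funM => //.
      exact: measurable_funX.
    under eq_integral do rewrite gee0_abs ?lee_fin ?expR_ge0//.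
    by rewrite E ltry.
  move=> t _; rewrite -EFinM -EFinD lee_fin mul0r oppr0 add0r.
  exact: expR_ge1Dx.
apply/eqP; apply: contraT => m0.
have m20 : 0 < m ^+ 2 by rewrite exprn_even_gt0.
(* The value [th = m / q] is small enough to have [a + b < 1] below. Multiplied by
   [1 - y <= exp (- y)], the bound becomes [(1 + a) * (1 - a * b / 2) <= 1], which fails for such
   positive [a] and [b]. *)
pose q := 1 + m ^+ 2 + sigma ^+ 2.
have q0 : 0 < q by rewrite /q; have := sqr_ge0 sigma; lra.
have := key (m / q).
set y := (X in expR X) => ky.
have kym : (1 + m / q * m) * (1 - y) <= 1.
  have e1 : 1 - y <= expR (- y) by exact: expR_ge1Dx.
  have [y1|y1] := leP 0 (1 - y); last first.
    apply: le_trans (_ : 0 <= 1) => //; rewrite mulr_ge0_le0 ?(ltW y1)//.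
    by rewrite addr_ge0// mulrAC -expr2 divr_ge0 ?sqr_ge0// ltW.
  rewrite -[leRHS](expRxMexpNx_1 y); apply: ler_pM => //.
  by rewrite addr_ge0// mulrAC -expr2 divr_ge0 ?sqr_ge0// ltW.
pose a := m ^+ 2 / q; pose b := sigma ^+ 2 / q.
have a0 : 0 < a by rewrite divr_gt0.
have b0 : 0 < b by rewrite divr_gt0// exprn_gt0.
have ab : a + b < 1.
  by rewrite /a /b -mulrDl ltr_pdivrMr// mul1r /q; lra.
have yE : y = a * b / 2 by rewrite /y /a /b; field; rewrite gt_eqF.
have aE : m / q * m = a by rewrite /a mulrAC -expr2.
move: kym; rewrite yE aE => kym.
have contra (x z : R) : 0 < x -> 0 < z -> x + z < 1 ->
    (1 + x) * (1 - x * z / 2) <= 1 -> False.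
  move=> x0 z0 xz; have xz1 : x * z < 1 by nra.
  have : 0 < x * (1 - z / 2 - x * z / 2) by rewrite mulr_gt0//; lra.
  rewrite (_ : (1 + x) * _ = 1 + x * (1 - z / 2 - x * z / 2)); last by field.
  lra.
by have := contra _ _ a0 b0 ab kym.
Qed.

End gaussian.

(** * A lower bound for the probability of a small sum of shifted squares *)

Section weight_lower_bound.
Context {R : realType}.

(** The inequality [1 + x <= exp x] is used at half the exponent and squared. This retains a
    second-order term, the source of the gain [s ^+ 2 / 16] in [tilt_mean_ge]. *)
Lemma add1r_le_expR (s : R) : 0 <= s <= 1 ->
  1 + s <= expR (s - s ^+ 2 / 8).
Proof.
move=> /andP[s0 s1].
have -> : s - s ^+ 2 / 8 = 2^-1 * (s - s ^+ 2 / 8) + 2^-1 * (s - s ^+ 2 / 8).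
  by field.
rewrite expRD.
have h : 1 + 2^-1 * (s - s ^+ 2 / 8) <= expR (2^-1 * (s - s ^+ 2 / 8)).
  exact: expR_ge1Dx.
have h0 : 0 <= 1 + 2^-1 * (s - s ^+ 2 / 8) by nra.
apply: le_trans (ler_pM h0 h0 h h).
have -> : (1 + 2^-1 * (s - s ^+ 2 / 8)) * (1 + 2^-1 * (s - s ^+ 2 / 8)) =
  1 + s + s ^+ 2 / 4 * ((1 - s / 8) ^+ 2 - 2^-1) by field.
rewrite lerDl mulr_ge0 ?mulr_ge0 ?sqr_ge0//; nra.
Qed.

(** Invert [1 - x <= exp (- x)]: the product [(1 + s) * (1 - s + s ^+ 2) = 1 + s ^+ 3] is at least
    1. *)
Lemma expR_le_add1r (s : R) : 0 <= s -> expR (s - s ^+ 2) <= 1 + s.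
Proof.
move=> s0.
have h : 1 - (s - s ^+ 2) <= expR (- (s - s ^+ 2)) by exact: expR_ge1Dx.
have h0 : 0 < 1 - (s - s ^+ 2) by nra.
have : expR (s - s ^+ 2) <= (1 - (s - s ^+ 2))^-1.
  by rewrite -[leLHS]invrK lef_pV2 ?posrE ?invr_gt0 ?expR_gt0// -expRN.
move=> /le_trans; apply; rewrite -div1r ler_pdivrMr//.
have -> : (1 + s) * (1 - (s - s ^+ 2)) = 1 + s ^+ 3 by ring.
by rewrite lerDl exprn_ge0.
Qed.

Context {d : measure_display} {T : measurableType d} (P : probability T R).
Context {I : choiceType} (X : I -> {RV P >-> R}) (sigma : R).
Hypotheses (sigma_gt0 : 0 < sigma) (XG : iid_gaussian sigma X).

(** Exponential tilt of one summand: over a window the product is [exp (- l Y)], with [Y] the excess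
    of the sum of squares over the value expected from the noise alone. *)
Let tilt (l a x : R) : R := expR (- (l * ((a - x) ^+ 2 - sigma ^+ 2))).

Let tilt_ge0 l a x : 0 <= tilt l a x. Proof. exact: expR_ge0. Qed.

Let measurable_tilt l a : measurable_fun setT (tilt l a).
Proof.
apply: measurableT_comp => //; apply: measurable_funN; apply: measurable_funM => //.
apply: measurable_funB => //; apply: measurable_funX.
exact: measurable_funB.
Qed.

Let tilt_mean (l a : R) : R :=
  expR (l * sigma ^+ 2) * (Num.sqrt (1 + 2 * l * sigma ^+ 2))^-1 *
  expR (- (l * a ^+ 2 / (1 + 2 * l * sigma ^+ 2))).

Let integral_tilt (l a : R) k : 0 <= l ->
  (\int[P]_t (tilt l a (X k t))%:E = (tilt_mean l a)%:E)%E.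
Proof.
move=> l0.
rewrite (eq_integral (fun t => (expR (l * sigma ^+ 2))%:E *
    (expR (- (l * (a - X k t) ^+ 2)))%:E)%E); last first.
  by move=> t _; rewrite -EFinM -expRD; congr (expR _)%:E; ring.
rewrite ge0_integralZl_EFin//; last first.
  apply/measurable_EFinP; apply: measurableT_comp => //; apply: measurable_funN.
  apply: measurable_funM => //; apply: measurable_funX.
  exact: measurable_funB.
have v0 : 0 < 1 + 2 * l * sigma ^+ 2.
  by rewrite ltr_pwDl// mulr_ge0 ?sqr_ge0// mulr_ge0.
by rewrite (gaussian_expR_sqr_dist sigma_gt0 (XG.2 k))// -EFinM mulrA.
Qed.

(** With [s = 2 * l * sigma ^+ 2], the factor free of the shift is [exp (s / 2) / sqrt (1 + s)], at
    least [exp (s ^+ 2 / 16)] by [add1r_le_expR]; the shift costs at most a factor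
    [exp (- l a ^+ 2)]. *)
Let tilt_mean_ge (l a : R) : 0 <= l -> 2 * l * sigma ^+ 2 <= 1 ->
  expR ((2 * l * sigma ^+ 2) ^+ 2 / 16 - l * a ^+ 2) <= tilt_mean l a.
Proof.
rewrite /tilt_mean => l0; set s := 2 * l * sigma ^+ 2 => s1.
have s0 : 0 <= s by rewrite mulr_ge0 ?sqr_ge0// mulr_ge0.
have v0 : 0 < 1 + s by rewrite ltr_pwDl.
rewrite expRD ler_pM ?expR_ge0//; last first.
  rewrite ler_expR lerN2 ler_pdivrMr// ler_peMr//.
    by rewrite mulr_ge0 ?sqr_ge0.
  by rewrite lerDl.
have lE : l * sigma ^+ 2 = s / 2 by rewrite /s; field.
rewrite lE ler_pdivlMr ?sqrtr_gt0// mulrC -ler_pdivlMr ?expR_gt0//.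
rewrite -expRN -expRD -ler_sqr ?nnegrE ?sqrtr_ge0 ?expR_ge0// sqr_sqrtr ?(ltW v0)//.
rewrite [leRHS]expr2 -expRD.
have -> : s / 2 - s ^+ 2 / 16 + (s / 2 - s ^+ 2 / 16) = s - s ^+ 2 / 8 by field.
by apply: add1r_le_expR; rewrite s0.
Qed.

Let tilt_mean_ge0 (l a : R) : 0 <= tilt_mean l a.
Proof. by rewrite !mulr_ge0 ?expR_ge0// invr_ge0 sqrtr_ge0. Qed.

Let tilt_mean_le (l a : R) : 0 <= l ->
  tilt_mean l a <= expR ((2 * l * sigma ^+ 2) ^+ 2 / 2).
Proof.
rewrite /tilt_mean => l0; set s := 2 * l * sigma ^+ 2.
have s0 : 0 <= s by rewrite mulr_ge0 ?sqr_ge0// mulr_ge0.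
have v0 : 0 < 1 + s by rewrite ltr_pwDl.
rewrite -[leRHS]mulr1 ler_pM ?expR_ge0//.
- have lE : l * sigma ^+ 2 = s / 2 by rewrite /s; field.
  rewrite lE ler_pdivrMr ?sqrtr_gt0// [leRHS]mulrC -ler_pdivrMr ?expR_gt0//.
  rewrite -expRN -expRD -ler_sqr ?nnegrE ?sqrtr_ge0 ?expR_ge0// sqr_sqrtr ?(ltW v0)//.
  rewrite [leLHS]expr2 -expRD.
  have -> : s / 2 - s ^+ 2 / 2 + (s / 2 - s ^+ 2 / 2) = s - s ^+ 2 by field.
  exact: expR_le_add1r.
- rewrite -[leRHS]expR0 ler_expR oppr_le0 divr_ge0 ?(ltW v0)//.
  by rewrite mulr_ge0 ?sqr_ge0.
Qed.

Let integral_prod_tilt (nb : seq I) (l : R) (a : I -> R) : uniq nb -> 0 <= l ->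
  (\int[P]_t (\prod_(k <- nb) tilt l (a k) (X k t))%:E =
   (\prod_(k <- nb) tilt_mean l (a k))%:E)%E.
Proof.
move=> unb l0.
rewrite (@indep_integral_prod _ _ _ P _ X XG.1 nb (fun k => tilt l (a k)))//.
rewrite (eq_bigr (fun k => (tilt_mean l (a k))%:E)) ?prodEFin// => k _.
exact: integral_tilt.
Qed.

Let prod_tilt (nb : seq I) (l : R) (a : I -> R) t :
  \prod_(k <- nb) tilt l (a k) (X k t) =
  expR (- (l * (\sum_(k <- nb) (a k - X k t) ^+ 2 - (size nb)%:R * sigma ^+ 2))).
Proof.
rewrite /tilt -expR_sum sumrN -mulr_sumr big_split/=.
by rewrite sumrN big_const_seq count_predT iter_addr_0 mulr_natl.
Qed.

(** A second moment argument in the manner of Paley and Zygmund for [U = exp (- l Y)]. Off the event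
    [U] is at most 1, so part of a mean of at least 2 comes from the event, and [E U^2 <= M] then
    forces its probability to be at least [1 / M]. *)
Lemma prob_shifted_sum_sqr_ge (nb : seq I) (a : I -> R) (s A : R) : uniq nb ->
  0 < s <= 1 -> \sum_(k <- nb) a k ^+ 2 <= A ->
  1 <= (size nb)%:R * s ^+ 2 / 16 - A * s / (2 * sigma ^+ 2) ->
  ((expR (- (2 * (size nb)%:R * s ^+ 2)))%:E <=
   P [set t | (\sum_(k <- nb) (a k - X k t) ^+ 2 <=
               (size nb)%:R * sigma ^+ 2)%R])%E.
Proof.
move=> unb /andP[s0 s1] aA sA.
set K := (size nb)%:R : R.
pose l := s / (2 * sigma ^+ 2).
have sg0 : sigma != 0 by rewrite gt_eqF.
have l0 : 0 < l by rewrite divr_gt0// mulr_gt0// exprn_gt0.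
have lE : 2 * l * sigma ^+ 2 = s by rewrite /l; field.
pose U t := \prod_(k <- nb) tilt l (a k) (X k t).
pose U2 t := \prod_(k <- nb) tilt (2 * l) (a k) (X k t).
pose M := expR (2 * K * s ^+ 2).
have M0 : 0 < M by exact: expR_gt0.
(* The last hypothesis bounds the total exponent below by 1, and [exp x >= 1 + x] gives 2. *)
have EU : (2%:E <= \int[P]_t (U t)%:E)%E.
  rewrite /U integral_prod_tilt ?(ltW l0)// lee_fin.
  apply: (@le_trans _ _ (\prod_(k <- nb) expR (s ^+ 2 / 16 - l * a k ^+ 2))).
    have sumE : \sum_(k <- nb) (s ^+ 2 / 16 - l * a k ^+ 2) =
        K * (s ^+ 2 / 16) - l * \sum_(k <- nb) a k ^+ 2.
      rewrite big_split/= sumrN mulr_sumr big_const_seq count_predT iter_addr_0.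
      by rewrite mulr_natl.
    rewrite -expR_sum sumE.
    have : l * \sum_(k <- nb) a k ^+ 2 <= l * A by rewrite ler_pM2l.
    have lA : l * A = A * s / (2 * sigma ^+ 2) by rewrite /l; field.
    move=> laA; apply: le_trans (expR_ge1Dx _).
    move: sA laA; rewrite -/K lA; move: (A * s / _) (l * \sum_(i <- nb) _) => x y.
    lra.
  apply: ler_prod => k _; rewrite expR_ge0/= -{1}lE tilt_mean_ge ?lE//.
  exact: ltW.
(* [U2] is the square of [U]: doubling [l] turns [s] into [2 s], whence an exponent
   [(2 s)^2 / 2 = 2 s^2] per factor. *)
have EU2 : (\int[P]_t (U2 t)%:E <= M%:E)%E.
  have l20 : 0 <= 2 * l by rewrite mulr_ge0// ltW.
  rewrite /U2 integral_prod_tilt// lee_fin.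
  apply: (@le_trans _ _ (\prod_(k <- nb) expR (2 * s ^+ 2))).
    apply: ler_prod => k _; rewrite tilt_mean_ge0/=.
    apply: le_trans (tilt_mean_le _ l20) _.
    rewrite ler_expR -mulrA -[_ * l * _]mulrA [_ * (l * _)]mulrA lE; lra.
  rewrite /M -expR_sum ler_expR big_const_seq count_predT iter_addr_0.
  by rewrite -[leLHS]mulr_natl -/K mulrCA mulrA.
set E := [set t | _].
have mU : measurable_fun setT U.
  exact: (sigma_measurableW (@sigma_measurable_prod_coord _ _ _ P _ X nb _
    (fun k => measurable_tilt l (a k)))).
have mU2 : measurable_fun setT U2.
  exact: (sigma_measurableW (@sigma_measurable_prod_coord _ _ _ P _ X nb _
    (fun k => measurable_tilt (2 * l) (a k)))).
have mE : measurable E.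
  rewrite -[E]setTI (_ : E = (fun t => \sum_(k <- nb) (a k - X k t) ^+ 2) @^-1`
    `]-oo, K * sigma ^+ 2]); last by apply/seteqP; split => t; rewrite /= in_itv.
  by apply: (sigma_measurableW (@sigma_measurable_sum_sqr_dist _ _ _ P _ X nb a)).
have U2E t : U2 t = U t ^+ 2.
  by rewrite /U2 /U !prod_tilt [RHS]expr2 -expRD; congr expR; ring.
have UE t : ~ E t -> U t <= 1.
  rewrite /E/= /U prod_tilt => /negP; rewrite -ltNge => h.
  by rewrite -[leRHS]expR0 ler_expR oppr_le0 mulr_ge0 ?(ltW l0)// subr_ge0 ltW.
have U0 t : 0 <= U t by apply: prodr_ge0 => k _; exact: tilt_ge0.
(* [U = exp (- l Y)] is at most [1] off [E] and, by AM-GM, at most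
   [U^2 / (2 M) + M / 2] on [E]. *)
have UM t : U t <= 1 + (2 * M)^-1 * U2 t + M / 2 * \1_E t.
  rewrite U2E indicE.
  have q0 : 0 <= (2 * M)^-1 * U t ^+ 2.
    by rewrite mulr_ge0 ?sqr_ge0// invr_ge0 mulr_ge0// ltW.
  have [tE|tE] := pselect (E t).
    rewrite mem_set//= mulr1.
    have -> : 1 + (2 * M)^-1 * U t ^+ 2 + M / 2 =
       1 + U t + (2 * M)^-1 * (U t - M) ^+ 2 by field; rewrite gt_eqF.
    have : 0 <= (2 * M)^-1 * (U t - M) ^+ 2.
      by rewrite mulr_ge0 ?sqr_ge0// invr_ge0 mulr_ge0// ltW.
    lra.
  by rewrite memNset//= mulr0 addr0; have := UE t tE; lra.
have : (2%:E <= 1%:E + (2 * M)^-1%:E * M%:E + (M / 2)%:E * P E)%E.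
  apply: (le_trans EU); apply: (@le_trans _ _
      (\int[P]_t ((1%:E + (2 * M)^-1%:E * (U2 t)%:E) + (M / 2)%:E * (\1_E t)%:E))%E).
    have mind : measurable_fun setT (\1_E : T -> R) by exact: measurable_indic.
    apply: ge0_le_integral => //.
    - by move=> t _; rewrite lee_fin.
    - exact/measurable_EFinP.
    - apply/measurable_EFinP; apply: measurable_funD; last exact: measurable_funM.
      by apply: measurable_funD => //; exact: measurable_funM.
    - by move=> t _; rewrite -!EFinM -!EFinD lee_fin.
  have c0 : 0 <= (2 * M)^-1 by rewrite invr_ge0 mulr_ge0// ltW.
  have d0 : 0 <= M / 2 by rewrite divr_ge0// ltW.
  have U20 t : 0 <= U2 t by rewrite U2E sqr_ge0.
  have mcU2 : measurable_fun setT (fun t => ((2 * M)^-1%:E * (U2 t)%:E)%E).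
    by apply/measurable_EFinP; exact: measurable_funM.
  rewrite ge0_integralD//=; last 4 first.
  - by move=> t _; rewrite -EFinM -EFinD lee_fin addr_ge0// mulr_ge0.
  - by apply: emeasurable_funD.
  - by move=> t _; rewrite -EFinM lee_fin mulr_ge0.
  - by apply/measurable_EFinP; apply: measurable_funM => //; exact: measurable_indic.
  rewrite ge0_integralD//=; last first.
  - by move=> t _; rewrite -EFinM lee_fin mulr_ge0.
  rewrite ge0_integralZl_EFin//; last 2 first.
  - by move=> t _; rewrite lee_fin.
  - exact/measurable_EFinP.
  rewrite ge0_integralZl_EFin//; last first.
    by apply/measurable_EFinP; exact: measurable_indic.
  rewrite integral_cst_probability integral_indic// setIT.
  by rewrite leeD2r// leeD2l// lee_wpmul2l.
have PEfin : P E \is a fin_num by exact: fin_num_measure.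
rewrite -(fineK PEfin) -!EFinM -!EFinD !lee_fin expRN -/M => h.
rewrite -div1r ler_pdivrMr//.
have e1 : (2 * M)^-1 * M = 2^-1 by field; rewrite gt_eqF.
rewrite e1 in h; lra.
Qed.

End weight_lower_bound.

(** * Moment bounds *)

Section moment_bounds.
Context {R : realType} {d : measure_display} {T : measurableType d}.
Context (P : probability T R).

Lemma measurable_set_lt (f : T -> R) (c : R) :
  measurable_fun setT f -> measurable [set t | f t < c].
Proof.
move=> mf; rewrite (_ : [set t | _] = f @^-1` `]-oo, c[).
  by rewrite -[X in measurable X]setTI; exact: mf.
by apply/seteqP; split => t; rewrite /= in_itv.
Qed.

Lemma measurable_set_le_norm (f : T -> R) (c : R) :
  measurable_fun setT f -> measurable [set t | c <= `|f t|].
Proof.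
move=> mf; rewrite (_ : [set t | _] = (fun t => `|f t|) @^-1` `[c, +oo[).
  have mn := measurableT_comp (@normr_measurable R setT) mf.
  by rewrite -[X in measurable X]setTI; exact: mn.
by apply/seteqP; split => t; rewrite /= in_itv/= andbT.
Qed.

(** Markov's inequality for an [f] not assumed measurable, so that it applies directly to the
    integrand of the risk: the integral of a nonnegative function is a supremum over the simple
    functions below it, hence monotone. *)
Lemma lower_bound_integral (f : T -> R) (E : set T) (c : R) :
  measurable E -> 0 <= c -> (forall t, 0 <= f t) -> (forall t, E t -> c <= f t) ->
  (c%:E * P E <= \int[P]_t (f t)%:E)%E.
Proof.
move=> mE c0 f0 cf.
have mi : measurable_fun setT (\1_E : T -> R) by exact: measurable_indic.
have -> : (c%:E * P E = \int[P]_t (c * \1_E t)%:E)%E.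
  under eq_integral do rewrite EFinM.
  rewrite ge0_integralZl_EFin//; last exact/measurable_EFinP.
  by rewrite integral_indic// setIT.
have cE t : c * \1_E t <= f t.
  rewrite indicE; have [tE|tE] := pselect (E t).
    by rewrite mem_set// mulr1 cf.
  by rewrite memNset// mulr0.
rewrite !ge0_integralTE//; last by move=> t; rewrite lee_fin mulr_ge0.
apply: ereal_sup_le => _ [h hc <-]; exists h => // t.
by apply: le_trans (hc t) _; rewrite lee_fin.
Qed.

Lemma sqr_integrableM (f g : T -> R) :
  measurable_fun setT f -> measurable_fun setT g ->
  P.-integrable setT (fun t => (f t ^+ 2)%:E) ->
  P.-integrable setT (fun t => (g t ^+ 2)%:E) ->
  P.-integrable setT (fun t => (f t * g t)%:E).
Proof.
move=> mf mg fi gi.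
apply: (le_integrable measurableT _ _ (integrableD measurableT fi gi)).
  by apply/measurable_EFinP; exact: measurable_funM.
move=> t _; rewrite /=  lee_fin normrM.
rewrite [leRHS]ger0_norm ?addr_ge0 ?sqr_ge0//.
rewrite -[in leRHS](real_normK (num_real (f t))) -[in leRHS](real_normK (num_real (g t))).
have := sqr_ge0 (`|f t| - `|g t|); have := normr_ge0 (f t); have := normr_ge0 (g t).
nra.
Qed.

(** In the expanded square, unrelated pairs integrate to 0 and related ones to at most [M], by
    [2 a b <= a^2 + b^2]. The bound thus counts dependent pairs only. *)
Lemma second_moment_local_dependence (J : eqType) (s : seq J) (u : J -> T -> R)
    (r : rel J) (M : R) :
  (forall a, measurable_fun setT (u a)) ->
  (forall a, (\int[P]_t (u a t ^+ 2)%:E <= M%:E)%E) ->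
  {in s &, forall a b, ~~ r a b -> \int[P]_t (u a t * u b t) = 0} ->
  (\int[P]_t ((\sum_(a <- s) u a t) ^+ 2)%:E <=
   (M * (\sum_(a <- s) \sum_(b <- s) r a b)%:R)%:E)%E.
Proof.
move=> mu uM ru.
have ui a : P.-integrable setT (fun t => (u a t ^+ 2)%:E).
  apply/integrableP; split.
    by apply/measurable_EFinP; exact: measurable_funX.
  apply: le_lt_trans (ltry M); apply: le_trans (uM a).
  by under eq_integral do rewrite gee0_abs ?lee_fin ?sqr_ge0//.
have uui a b : P.-integrable setT (fun t => (u a t * u b t)%:E).
  exact: sqr_integrableM.
rewrite (eq_integral (fun t => \sum_(a <- s) \sum_(b <- s) (u a t * u b t)%:E)%E);
  last first.
  move=> t _; rewrite expr2 mulr_suml -sumEFin; apply: eq_bigr => a _.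
  by rewrite mulr_sumr -sumEFin.
rewrite (integral_sum measurableT (f := fun a t => \sum_(b <- s) (u a t * u b t)%:E)%E);
  last by move=> a; exact: integrable_sum.
rewrite natr_sum mulr_sumr -sumEFin big_seq [leRHS]big_seq.
apply: lee_sum => a sa.
rewrite (integral_sum measurableT (f := fun b t => (u a t * u b t)%:E)%E)//.
rewrite natr_sum mulr_sumr -sumEFin big_seq [leRHS]big_seq.
apply: lee_sum => b sb.
case rab : (r a b); last first.
  rewrite mulr0 -(fineK (integrable_fin_num measurableT (uui a b))).
  by rewrite -/(Rintegral _ _ _) ru ?rab.
rewrite mulr1.
apply: (@le_trans _ _
    (\int[P]_t ((2^-1)%:E * ((u a t ^+ 2)%:E + (u b t ^+ 2)%:E)))%E).
  apply: le_integral => //.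
    by apply: integrableZl => //; exact: integrableD.
  move=> t _; rewrite -EFinD -EFinM lee_fin.
  by have := sqr_ge0 (u a t - u b t); nra.
rewrite integralZl//; last exact: integrableD.
rewrite integralD// lee_pdivrMl// -EFinM mulrC mulr_natr mulr2n EFinD.
exact: leeD.
Qed.

End moment_bounds.

(** * The flat edge and its windows *)

Section flat_edge.
Context {R : realType}.

Lemma holder_cst (alpha C c : R) : 0 <= C -> holder alpha C (cst c).
Proof.
move=> C0; rewrite /holder/=.
have D0 k : derive1n k (cst c : R -> R) = cst (if k is 0%N then c else 0).
  elim: k => [//|k IHk]; rewrite derive1nS IHk.
  by apply/funext => x; rewrite derive1_cst.
case: ifP => _ //.
  by move=> t t'; rewrite subrr normr0 mulr_ge0.
split.
  by move=> k _ t; rewrite D0; exact: derivable_cst.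
by move=> t t'; rewrite D0 /= subrr normr0 mulr_ge0// powR_ge0.
Qed.

Definition flat_edge : R * R -> R := hypograph_image (cst 1).

Lemma horizon_class_flat_edge (alpha C : R) : 0 <= C ->
  horizon_class alpha C flat_edge.
Proof. by move=> C0; exists (cst 1) => //; split; exact: holder_cst. Qed.

(** The edge runs along pixel borders: the upper side of a pixel of row [j < n] is at height at most
    1, the lower side of one with [j >= n] at height at least 1. So the image is constant on every
    pixel. *)
Lemma pixel_avg_flat_edge n (i j : int) : (0 < n)%N ->
  pixel_avg flat_edge n i j = (j < n%:Z)%R%:R.
Proof.
move=> n0; rewrite /pixel_avg.
have n0R : 0 < n%:R :> R by rewrite ltr0n.
have zR (k : int) : k < n%:Z -> (k + 1)%:~R / n%:R <= 1 :> R.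
  by move=> kn; rewrite ler_pdivrMr// mul1r -[leRHS]/(n%:~R) ler_int; lia.
have edgeE u : pixel n i j u -> flat_edge u = (j < n%:Z)%R%:R.
  move=> [_ /=]; rewrite in_itv/= => /andP[ju uj]; rewrite /flat_edge/hypograph_image/=.
  have [jn|jn] := ltP j n%:Z; first by rewrite (lt_le_trans uj (zR _ jn)).
  rewrite ltNge (le_trans _ ju)// ler_pdivlMr// mul1r.
  by rewrite -[leLHS]/(n%:~R) ler_int.
rewrite (@eq_Rintegral _ _ _ _ _ (fun=> (j < n%:Z)%R%:R)); last first.
  by move=> u; rewrite inE => /edgeE.
have side (k : int) :
    lebesgue_measure (`[k%:~R / n%:R, (k + 1)%:~R / n%:R[%classic : set R) =
    (n%:R^-1)%:E.
  rewrite lebesgue_measure_itv/= lte_fin ltr_pM2r ?invr_gt0// ltr_int ltrDl ltr01.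
  by rewrite -EFinB -mulrBl intrD addrAC subrr add0r mul1r.
rewrite Rintegral_cst; last exact: measurableX.
have area : (lebesgue_measure \x lebesgue_measure)%E (pixel n i j) =
    (n%:R^-1 * n%:R^-1 : R)%:E.
  rewrite EFinM -{1}(side i) -(side j).
  exact: product_measure1E.
rewrite (_ : fine _ = n%:R^-1 * n%:R^-1); last exact: (congr1 fine area).
by rewrite mulrC -mulrA -invfM -expr2 mulVf ?mulr1// expf_neq0// gt_eqF.
Qed.

End flat_edge.

Section windows.
Context {R : realType}.

Definition window_shift (delta : nat) (c : int * int)
    (o : 'I_(2 * delta + 1) * 'I_(2 * delta + 1)) : int * int :=
  (c.1 + (o.1%:Z - delta%:Z), c.2 + (o.2%:Z - delta%:Z)).

Lemma window_center_subproof delta : (delta < 2 * delta + 1)%N.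
Proof. by lia. Qed.

Definition window_center delta : 'I_(2 * delta + 1) * 'I_(2 * delta + 1) :=
  (Ordinal (window_center_subproof delta), Ordinal (window_center_subproof delta)).

(** As a duplicate-free list of pixels, the punctured window serves both as a range of summation and
    as a block for [sigma_measurable]. *)
Definition window (delta : nat) (c : int * int) : seq (int * int) :=
  [seq window_shift c o | o <- enum [pred o | o != window_center delta]].

Lemma window_shift_inj delta c : injective (@window_shift delta c).
Proof.
move=> [l m] [l' m'] [] /addrI /addIr [ll'] /addrI /addIr [mm'].
by congr pair; exact: val_inj.
Qed.

Lemma window_uniq delta c : uniq (window delta c).
Proof. by rewrite map_inj_uniq ?enum_uniq//; exact: window_shift_inj. Qed.

Lemma window_shift_center delta c : window_shift c (window_center delta) = c.
Proof. by case: c => i j; rewrite /window_shift/= !subrr !addr0. Qed.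

Lemma window_center_notin delta c : c \notin window delta c.
Proof.
apply/mapP; case=> o; rewrite mem_enum inE => oc.
rewrite -{1}(window_shift_center delta c) => /window_shift_inj e.
by rewrite -e eqxx in oc.
Qed.

Lemma size_window delta c : size (window delta c) = ((2 * delta + 1) ^ 2 - 1)%N.
Proof.
rewrite size_map -cardE -cardsE.
have -> : [set o in [pred o | o != window_center delta]] = ~: [set window_center delta].
  by apply/setP => o; rewrite !inE.
by rewrite cardsC1 card_prod card_ord subn1 mulnn.
Qed.

Lemma mem_window delta c k : k \in window delta c ->
  (`|k.1 - c.1| <= delta%:Z) && (`|k.2 - c.2| <= delta%:Z).
Proof.
move=> /mapP[[l m] _ ->]/=.
by have := ltn_ord l; have := ltn_ord m; lia.
Qed.

Lemma big_window delta c (F : int * int -> R) :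
  \sum_(k <- window delta c) F k =
  \sum_(o | o != window_center delta) F (window_shift c o).
Proof. by rewrite big_map big_enum. Qed.

(** The term subtracted in [nbhd_dist2] is the central one; the rest is reindexed by the pixels of
    the second window, the noisy one in the weights. *)
Lemma nbhd_dist2E delta (u v : int -> int -> R) (i j q p : int) :
  nbhd_dist2 delta u v i j q p =
  ((2 * delta + 1) ^ 2 - 1)%:R^-1 *
  \sum_(k <- window delta (q, p))
    (u (i + (k.1 - q)) (j + (k.2 - p)) - v k.1 k.2) ^+ 2.
Proof.
rewrite /nbhd_dist2; congr (_ * _); rewrite big_window exchange_big pair_big/=.
rewrite (bigD1 (window_center delta))//= !subrr !addr0.
rewrite [X in X - _]addrC addrK; apply: eq_bigr; case=> l m _ /=.
by rewrite real_normK ?num_real// ![_ + _ - _]addrAC !subrr !add0r.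
Qed.

Lemma size_window_gt0 delta : (0 < delta)%N ->
  0 < ((2 * delta + 1) ^ 2 - 1)%:R :> R.
Proof. by move=> d0; rewrite ltr0n; nia. Qed.

(** A column meets a given row in at most one pixel, and the window spans [2 * delta + 1]
    columns. *)
Lemma big_window_row_le delta c (j : int) :
  \sum_(k <- window delta c) (k.2 == j)%:R <= (2 * delta + 1)%:R :> R.
Proof.
rewrite big_window -natr_sum ler_nat.
apply: (@leq_trans (\sum_(o : 'I_(2 * delta + 1) * 'I_(2 * delta + 1))
    ((window_shift c o).2 == j))).
  by rewrite [leqRHS](bigD1 (window_center delta))//= leq_addl.
rewrite -(pair_bigA _ (fun l m => ((window_shift c (l, m)).2 == j) : nat))/=.
rewrite -[leqRHS]card_ord -sum1_card; apply: leq_sum => l _.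
have [/existsP[m0 /eqP m0j]|] := boolP [exists m : 'I_(2 * delta + 1), c.2 + (m%:Z - delta%:Z) == j].
  rewrite (bigD1 m0)//= big1 ?addn0 ?leq_b1// => m mm0.
  apply/eqP; rewrite eqb0; apply: contra mm0 => /eqP.
  by rewrite -m0j => /addrI /addIr [mm']; apply/eqP; exact: val_inj.
rewrite negb_exists => /forallP nj.
by rewrite big1// => m _; apply/eqP; rewrite eqb0; exact: nj.
Qed.

End windows.

(** * Weights of the edge row *)

(** The window around row [l] is all white, while around row [n] the nonnegative row offsets are
    black. The two differ at [(2 * delta + 1) * (delta + 1) - 1] of [(2 * delta + 1) ^ 2 - 1]
    places, more than half. *)
Lemma nbhd_dist2_edge_row_ge {R : realType} (delta n i m l : nat) :
  (0 < delta)%N -> (l + delta < n)%N ->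
  2^-1 <= nbhd_dist2 delta (pixel_avg flat_edge n) (pixel_avg flat_edge n)
    i%:Z n%:Z m%:Z l%:Z :> R.
Proof.
move=> delta_gt0 ln; have n_gt0 : (0 < n)%N by lia.
rewrite nbhd_dist2E.
rewrite ler_pdivlMl; last exact: size_window_gt0.
have step (a : int) : `|a - l%:Z| <= delta%:Z ->
    ((n%:Z + (a - l%:Z) < n%:Z)%R%:R - (a < n%:Z)%R%:R) ^+ 2 = (l%:Z <= a)%R%:R :> R.
  move=> al; rewrite (_ : (a < n%:Z)%R = true); last by lia.
  rewrite (_ : (n%:Z + (a - l%:Z) < n%:Z)%R = ~~ (l%:Z <= a)%R); last by lia.
  by case: (_ <= _)%R; rewrite /= ?subrr ?expr0n// sub0r sqrrN expr1n.
rewrite (eq_big_seq (fun k : int * int => (l%:Z <= k.2)%R%:R)); last first.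
  move=> k /mem_window /=/andP[_ kl]; rewrite !pixel_avg_flat_edge//.
  exact: step.
have count_row : (\sum_(m' < 2 * delta + 1) (delta <= m')%N)%N = delta.+1.
  rewrite -(big_mkord xpredT (fun m' => (delta <= m')%N : nat)).
  rewrite (@big_cat_nat _ _ _ delta)//=; last by lia.
  rewrite big_nat big1 ?add0n; last first.
    by move=> m' /andP[_ h]; apply/eqP; rewrite eqb0 -ltnNge.
  rewrite (@eq_big_nat _ _ _ _ _ _ (fun=> 1%N)); last by move=> m' /andP[->].
  by rewrite sum_nat_const_nat; lia.
have rowE (m' : 'I_(2 * delta + 1)) : (l%:Z <= l%:Z + (m'%:Z - delta%:Z))%R = (delta <= m')%N.
  by lia.
(* The centre is added back, to count over the full square. *)
have total : \sum_(k <- window delta (m%:Z, l%:Z)) (l%:Z <= k.2)%R%:R + 1 =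
    ((2 * delta + 1) * delta.+1)%:R :> R.
  rewrite big_window -[RHS](_ : \sum_(o : 'I_(2 * delta + 1) * 'I_(2 * delta + 1))
     (l%:Z <= (window_shift (m%:Z, l%:Z) o).2)%R%:R = _).
    by rewrite [RHS](bigD1 (window_center delta))// window_shift_center lexx addrC.
  rewrite -(pair_bigA _ (fun l' m' => (l%:Z <= (window_shift (m%:Z, l%:Z) (l', m')).2)%R%:R))/=.
  under eq_bigr do under eq_bigr do rewrite rowE.
  rewrite sumr_const card_ord -natr_sum count_row.
  by rewrite [RHS]natrM [RHS]mulrC mulr_natr.
rewrite -(lerD2r 1) total.
have -> : ((2 * delta + 1) ^ 2 - 1)%:R / 2 + 1 = (2 * delta * delta.+1 + 1)%:R :> R.
  rewrite (_ : ((2 * delta + 1) ^ 2 - 1 = 2 * (2 * delta * delta.+1))%N); last by nia.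
  by rewrite (natrM _ 2) natrD; field.
by rewrite ler_nat; nia.
Qed.

Section edge_row_weights.
Context {R : realType} {d : measure_display} {T : measurableType d}.
Context (P : probability T R) (sigma t : R) (delta n : nat).
Context (z : int * int -> {RV P >-> R}).
Hypotheses (sigma_gt0 : 0 < sigma) (t_gt0 : 0 < t) (n_gt0 : (0 < n)%N)
  (delta_gt0 : (0 < delta)%N) (noise : iid_gaussian sigma z).

(* Difference of the noiseless windows around a pixel of row [n], the only
   black row of the image, and around a pixel of row [p]. *)
Definition edge_shift (p : int) (k : int * int) : R :=
  (k.2 < p)%R%:R - (k.2 < n%:Z)%R%:R.

(** The weight of [c] common to all pixels of row [n], with the normalisation of the distance
    cleared. It sees the noise only through the punctured window of [c], hence not [z c]. *)
Definition edge_weight (c : int * int) (w : T) : R :=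
  (\sum_(k <- window delta c) (edge_shift c.2 k - z k w) ^+ 2 <=
   ((2 * delta + 1) ^ 2 - 1)%:R * (sigma ^+ 2 + t))%R%:R.

Lemma snlm_weight_edge_row (i q p : int) (w : T) :
  snlm_weight sigma t delta (pixel_avg flat_edge n) (observation flat_edge n z w)
    i n%:Z q p = edge_weight (q, p) w.
Proof.
rewrite /snlm_weight nbhd_dist2E /edge_weight.
rewrite ler_pdivrMl; last exact: size_window_gt0.
congr ((_ <= _)%R%:R); apply: eq_bigr => -k _; congr (_ ^+ 2).
rewrite /observation !pixel_avg_flat_edge// /edge_shift/= -surjective_pairing.
by rewrite gtrDl subr_lt0 opprD addrA.
Qed.

Lemma edge_weight01 c w : 0 <= edge_weight c w <= 1.
Proof. by rewrite /edge_weight ler0n lern1 leq_b1. Qed.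

Lemma edge_weight_ge0 c w : 0 <= edge_weight c w.
Proof. by have /andP[] := edge_weight01 c w. Qed.

Lemma edge_weight_le1 c w : edge_weight c w <= 1.
Proof. by have /andP[] := edge_weight01 c w. Qed.

Lemma edge_weight_indic c : edge_weight c = \1_[set w | edge_weight c w = 1].
Proof.
apply/funext => w; rewrite indicE; have [w1|w1] := pselect (edge_weight c w = 1).
  by rewrite mem_set.
rewrite memNset//; move: w1; rewrite /edge_weight.
by case: (_ <= _)%R => //= /(_ erefl).
Qed.

Lemma edge_weight_preimage c : [set w | edge_weight c w = 1] =
  (fun w => \sum_(k <- window delta c) (edge_shift c.2 k - z k w) ^+ 2) @^-1`
    `]-oo, ((2 * delta + 1) ^ 2 - 1)%:R * (sigma ^+ 2 + t)].
Proof.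
apply/seteqP; split=> w /=; rewrite in_itv/= /edge_weight; case: (_ <= _)%R => //=.
by move=> /esym/eqP; rewrite oner_eq0.
Qed.

Lemma sigma_measurable_edge_weight c :
  sigma_measurable z (window delta c) (edge_weight c).
Proof.
rewrite edge_weight_indic; apply: measurable_indic; rewrite edge_weight_preimage.
have h := @sigma_measurable_sum_sqr_dist _ _ _ P _ z (window delta c) (edge_shift c.2).
exact: (sigma_measurable_preimage h).
Qed.

Lemma measurable_edge_weight c : measurable_fun setT (edge_weight c).
Proof. exact: (sigma_measurableW (@sigma_measurable_edge_weight c)). Qed.

Lemma integral_edge_weight c :
  (\int[P]_w (edge_weight c w)%:E = P [set w | (edge_weight c w = 1)%R])%E.
Proof.
have mE : measurable [set w | edge_weight c w = 1].
  rewrite -[X in measurable X]setTI.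
  exact: (@measurable_edge_weight c measurableT _ (measurable_set1 1)).
by rewrite edge_weight_indic integral_indic// setIT -edge_weight_indic.
Qed.

Lemma integrable_edge_weight c : P.-integrable setT (EFin \o edge_weight c).
Proof.
have i1 : P.-integrable setT (EFin \o cst (1 : R)) by exact: finite_measure_integrable_cst.
apply: (le_integrable measurableT _ _ i1).
  by apply/measurable_EFinP; exact: measurable_edge_weight.
by move=> w _; rewrite /= lee_fin !ger0_norm ?edge_weight_ge0// edge_weight_le1.
Qed.

(* Row [n - 1] is white, but its windows differ from those of row [n] on a
   single row, which is less than the fluctuations of the noise detect. *)
Lemma integral_edge_weight_ge (B : R) (q : int) : B = 6 / sigma ^+ 2 + 4 ->
  B <= delta%:R ->
  ((expR (- (16 * B ^+ 2)))%:E <= \int[P]_w (edge_weight (q, n%:Z - 1) w)%:E)%E.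
Proof.
move=> BE Bd; rewrite integral_edge_weight.
set c := (q, n%:Z - 1).
have s20 : 0 < sigma ^+ 2 by rewrite exprn_gt0.
have i20 : 0 < 6 / sigma ^+ 2 by rewrite divr_gt0.
have B0 : 4 <= B by rewrite BE; lra.
have d1 : 1 <= delta%:R :> R by rewrite ler1n.
(* With this [s], the window size times [s ^+ 2] stays between [4 * B ^+ 2] and [8 * B ^+ 2]
   whatever [delta], so the final bound does not decay. *)
pose s := B / delta%:R.
have KE : (size (window delta c))%:R = 4 * delta%:R * (delta%:R + 1) :> R.
  rewrite size_window -[X in X%:R](_ : 4 * delta * (delta + 1) = _)%N; last by nia.
  by rewrite !natrM natrD.
have aE k : edge_shift c.2 k ^+ 2 = (k.2 == n%:Z - 1)%:R.
  rewrite /edge_shift/=; have [k1|k1|->] := ltgtP k.2 (n%:Z - 1).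
  - by rewrite (_ : k.2 < n%:Z)%R ?subrr ?expr0n//=; lia.
  - by rewrite (_ : (k.2 < n%:Z)%R = false) ?subrr ?expr0n//=; lia.
  - by rewrite (_ : (n%:Z - 1 < n%:Z)%R) ?sub0r ?sqrrN ?expr1n//=; lia.
have hA : \sum_(k <- window delta c) edge_shift c.2 k ^+ 2 <= (2 * delta + 1)%:R.
  by under eq_bigr do rewrite aE; exact: big_window_row_le.
have sd : s * delta%:R = B by rewrite /s mulfVK// gt_eqF// (lt_le_trans _ d1).
have hs : 0 < s <= 1.
  by rewrite divr_gt0 ?ler_pdivrMr ?mul1r//; lra.
have Ks : 4 * B ^+ 2 <= (size (window delta c))%:R * s ^+ 2 <= 8 * B ^+ 2.
  rewrite KE -sd exprMn; move/andP: hs => [s0 s1].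
  have -> : 4 * delta%:R * (delta%:R + 1) * s ^+ 2 =
    4 * (s ^+ 2 * delta%:R ^+ 2) + 4 * (s ^+ 2 * delta%:R) by ring.
  have sd0 : 0 <= s ^+ 2 * delta%:R by rewrite mulr_ge0 ?sqr_ge0.
  have : s ^+ 2 * delta%:R <= s ^+ 2 * delta%:R ^+ 2.
    by rewrite ler_wpM2l ?sqr_ge0// ler_eXnr.
  by move=> h; apply/andP; split; lra.
have hK : 1 <= (size (window delta c))%:R * s ^+ 2 / 16 -
    (2 * delta + 1)%:R * s / (2 * sigma ^+ 2).
  have h1 : (2 * delta + 1)%:R * s / (2 * sigma ^+ 2) <= 3 * B / (2 * sigma ^+ 2).
    rewrite ler_pM2r ?invr_gt0 ?mulr_gt0// -sd natrD natrM.
    by move/andP: hs => [s0 s1]; nra.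
  (* [B] was chosen to make this equality hold; since [B >= 4], the required 1 is reached. *)
  have h2 : B ^+ 2 / 4 - 3 * B / (2 * sigma ^+ 2) = B.
    have -> : 3 * B / (2 * sigma ^+ 2) = B * (B - 4) / 4.
      by rewrite BE; field; rewrite gt_eqF.
    by field.
  by move/andP: Ks => [k1 _]; lra.
have h := @prob_shifted_sum_sqr_ge _ _ _ P _ z sigma sigma_gt0 noise (window delta c)
  (edge_shift c.2) s (2 * delta + 1)%:R (window_uniq _ _) hs hA hK.
apply: (le_trans _ (le_trans h _)).
  rewrite lee_fin ler_expR lerN2 -mulrA; move/andP: Ks => [_].
  by move: (_ * s ^+ 2) => x; lra.
apply: le_measure.
- rewrite inE -[X in measurable X]setTI.
  rewrite (_ : [set w | _] = (fun w => \sum_(k <- window delta c)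
      (edge_shift c.2 k - z k w) ^+ 2) @^-1`
    `]-oo, (size (window delta c))%:R * sigma ^+ 2]); last first.
    by apply/seteqP; split => w; rewrite /= in_itv.
  have hm := @sigma_measurable_sum_sqr_dist _ _ _ P _ z (window delta c) (edge_shift c.2).
  by apply: (sigma_measurableW hm).
- rewrite inE -[X in measurable X]setTI.
  exact: (@measurable_edge_weight c measurableT _ (measurable_set1 1)).
move=> w /= hw; rewrite /edge_weight (le_trans hw)// size_window.
by rewrite ler_pM2l ?size_window_gt0// lerDl ltW.
Qed.

End edge_row_weights.

(** * Deviations of the weights and of the noise *)

Lemma sum_close_le (k n m : nat) :
  (\sum_(1 <= m' < n.+1) ((m <= m' + k) && (m' <= m + k)) <= 2 * k + 1)%N.
Proof.
have -> : (\sum_(1 <= m' < n.+1) ((m <= m' + k) && (m' <= m + k)) =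
    count (fun m' => (m <= m' + k) && (m' <= m + k)) (index_iota 1 n.+1))%N.
  by rewrite -sum1_count [RHS]big_mkcond; apply: eq_bigr => m' _; case: (_ && _).
rewrite -size_filter -(size_iota (m - k) (2 * k + 1)); apply: uniq_leq_size.
  by rewrite filter_uniq// iota_uniq.
move=> m'; rewrite mem_filter mem_iota => /andP[/andP[h1 h2] _]; lia.
Qed.

Section edge_row_deviations.
Context {R : realType} {d : measure_display} {T : measurableType d}.
Context (P : probability T R) (sigma t : R) (delta n : nat).
Context (z : int * int -> {RV P >-> R}).
Hypothesis noise : iid_gaussian sigma z.

Let W (m l : nat) := edge_weight sigma t delta n z (m%:Z, l%:Z).

Let W01 m l w : 0 <= W m l w <= 1. Proof. exact: edge_weight01. Qed.

Let sW m l : sigma_measurable z (window delta (m%:Z, l%:Z)) (W m l).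
Proof. exact: sigma_measurable_edge_weight. Qed.

Let mW m l : measurable_fun setT (W m l).
Proof. exact: measurable_edge_weight. Qed.

Let iW m l : P.-integrable setT (EFin \o W m l).
Proof. exact: integrable_edge_weight. Qed.

(** Chebyshev's inequality: the mean of the sum is at least [c * n], so the event is a deviation of
    more than [c * n / 2]. Columns more than [2 * delta] apart have disjoint windows, which leaves
    each weight at most [4 * delta + 1] correlated partners, itself included. *)
Lemma row_weight_deviation (c : R) (l : nat) : 0 < c ->
  (forall m : nat, (c%:E <= \int[P]_w (W m l w)%:E)%E) ->
  (((c * n%:R / 2) ^+ 2)%:E *
     P [set w | (\sum_(1 <= m < n.+1) W m l w < c * n%:R / 2)%R] <=
   (n * (4 * delta + 1))%:R%:E)%E.
Proof.
move=> c0 cW.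
pose p m := \int[P]_w W m l w.
pose u m w := W m l w - p m.
have pE m : (p m)%:E = (\int[P]_w (W m l w)%:E)%E.
  by rewrite /p /Rintegral fineK//; exact: (integrable_fin_num measurableT (iW m l)).
have cp m : c <= p m by rewrite -lee_fin pE.
have p1 m : p m <= 1.
  rewrite -lee_fin pE -(integral_cst_probability P 1).
  apply: ge0_le_integral => //.
  - by move=> w _; rewrite lee_fin; have /andP[] := W01 m l w.
  - exact/measurable_EFinP.
  - by move=> w _; rewrite lee_fin; have /andP[] := W01 m l w.
have su m : sigma_measurable z (window delta (m%:Z, l%:Z)) (u m).
  by apply: measurable_funB => //; exact: sW.
have mu m : measurable_fun setT (u m) by exact: (sigma_measurableW (su m)).
have u1 m w : u m w ^+ 2 <= 1.
  have := cp m; have := p1 m; have /andP[] := W01 m l w; rewrite /u; nra.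
have ic m : P.-integrable setT (EFin \o cst (p m)).
  exact: finite_measure_integrable_cst.
have iu m : P.-integrable setT (EFin \o u m).
  exact: (integrableB measurableT (iW m l) (ic m)).
have u0 m : \int[P]_w u m w = 0.
  rewrite (RintegralB measurableT (iW m l) (ic m)).
  by rewrite /Rintegral integral_cst_probability/= subrr.
pose r m m' := (m <= m' + 2 * delta)%N && (m' <= m + 2 * delta)%N.
have far m m' : ~~ r m m' -> \int[P]_w (u m w * u m' w) = 0.
  move=> rmm'; have us : uniq (window delta (m%:Z, l%:Z) ++ window delta (m'%:Z, l%:Z)).
    rewrite cat_uniq !window_uniq andbT/=; apply/hasPn => k /mem_window/= /andP[h1 _].
    apply/negP => /mem_window/= /andP[h2 _]; move: rmm' h1 h2; rewrite /r.
    by move: (k.1) => a; lia.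
  by rewrite (indep_RintegralM noise.1 us (su m) (su m') (iu m) (iu m')) !u0 mulr0.
have u2 m : (\int[P]_w (u m w ^+ 2)%:E <= 1%:E)%E.
  rewrite -(integral_cst_probability P 1); apply: ge0_le_integral => //.
  - by move=> w _; rewrite lee_fin sqr_ge0.
  - by apply/measurable_EFinP; exact: measurable_funX.
  - by move=> w _; rewrite lee_fin.
have sm := @second_moment_local_dependence _ _ _ P _ (index_iota 1 n.+1) u r 1 mu u2
  (fun m m' _ _ => @far m m').
have mS : measurable_fun setT (fun w => \sum_(1 <= m < n.+1) W m l w).
  exact: measurable_sum.
apply: le_trans (le_trans sm _).
  apply: lower_bound_integral.
  - exact: measurable_set_lt.
  - exact: sqr_ge0.
  - by move=> w; exact: sqr_ge0.
  move=> w /= hw.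
  have sp : c * n%:R <= \sum_(1 <= m < n.+1) p m.
    rewrite (@le_trans _ _ (\sum_(1 <= m < n.+1) c))//; last exact: ler_sum.
    by rewrite big_const_nat iter_addr_0 subSS subn0 mulr_natr.
  have cn0 : 0 <= c * n%:R by rewrite mulr_ge0 ?ler0n ?(ltW c0).
  rewrite sumrB -[leRHS]sqrrN opprB ler_sqr ?nnegrE; last 2 first.
  - lra.
  - lra.
  lra.
rewrite lee_fin mul1r ler_nat.
apply: (@leq_trans (\sum_(1 <= m < n.+1) (4 * delta + 1))).
  apply: leq_sum => m _; apply: leq_trans (sum_close_le (2 * delta) n m) _.
  by rewrite mulnA.
by rewrite sum_nat_const_nat subSS subn0.
Qed.

Hypothesis sigma_gt0 : 0 < sigma.

Let Z (m l : nat) : T -> R := z (m%:Z, l%:Z).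

Let mZ m l : measurable_fun setT (Z m l). Proof. by []. Qed.

(** Chebyshev's inequality again: beyond column distance [delta], the noise of one pixel is centred
    and independent of the three other factors of the product. There are [n * (delta + 1)] pixels,
    with at most [(2 * delta + 1) * (delta + 1)] partners each. *)
Lemma near_noise_deviation (e : R) : 0 <= e -> (delta < n)%N ->
  ((e ^+ 2)%:E * P [set w | (e <= `|\sum_(1 <= m < n.+1)
      \sum_(n - delta <= l < n.+1) W m l w * Z m l w|)%R] <=
   (8 * sigma ^+ 2 * (n * (2 * delta + 1) * (delta + 1) ^ 2)%:R)%:E)%E.
Proof.
move=> e0 dn.
pose s := [seq (m, l) | m <- index_iota 1 n.+1, l <- index_iota (n - delta) n.+1].
pose u (a : nat * nat) w := W a.1 a.2 w * Z a.1 a.2 w.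
pose r (a b : nat * nat) := (a.1 <= b.1 + delta)%N && (b.1 <= a.1 + delta)%N.
have sumE w : \sum_(1 <= m < n.+1) \sum_(n - delta <= l < n.+1) W m l w * Z m l w =
    \sum_(a <- s) u a w by rewrite big_allpairs_dep.
have mu a : measurable_fun setT (u a) by exact: measurable_funM.
have u2 a : (\int[P]_w (u a w ^+ 2)%:E <= (8 * sigma ^+ 2)%:E)%E.
  apply: le_trans (gaussian_integral_sqr_le sigma_gt0 (noise.2 (a.1%:Z, a.2%:Z))).
  apply: ge0_le_integral => //.
  - by move=> w _; rewrite lee_fin sqr_ge0.
  - by apply/measurable_EFinP; exact: measurable_funX.
  - by apply/measurable_EFinP; exact: measurable_funX.
  - move=> w _; rewrite lee_fin exprMn ler_piMl ?sqr_ge0//.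
    by have /andP[] := W01 a.1 a.2 w; rewrite expr_le1.
have iZ m l : P.-integrable setT (EFin \o Z m l).
  exact: (gaussian_integrable sigma_gt0 (noise.2 (m%:Z, l%:Z))).
have far a b : ~~ r a b -> \int[P]_w (u a w * u b w) = 0.
  case: a b => [m l] [m' l'] rab.
  pose c : int * int := (m%:Z, l%:Z); pose c' : int * int := (m'%:Z, l'%:Z).
  (* All the noise entering the three other factors; the two windows may overlap, hence [undup]. *)
  pose s2 := undup (window delta c ++ window delta c' ++ [:: c']).
  have us : uniq ([:: c] ++ s2).
    rewrite /= undup_uniq andbT mem_undup !mem_cat !negb_or window_center_notin/= andbT.
    apply/andP; split; last first.
      by apply/eqP; case=> mm' _; move: rab; rewrite /r/= mm'; lia.
    by apply/negP => /mem_window/= /andP[h _]; move: rab h; rewrite /r/=; lia.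
  rewrite (@eq_Rintegral _ _ _ _ _
      (fun w => Z m l w * (W m l w * (W m' l' w * Z m' l' w)))); last first.
    by move=> w _; rewrite /u/=; ring.
  have sZ : sigma_measurable z [:: c] (Z m l).
    by apply: sigma_measurable_coord; exact: mem_head.
  have sR : sigma_measurable z s2 (fun w => W m l w * (W m' l' w * Z m' l' w)).
    apply: measurable_funM.
      apply: sigma_measurable_sub (@sW m l) => k kc.
      by rewrite mem_undup mem_cat kc.
    apply: measurable_funM.
      apply: sigma_measurable_sub (@sW m' l') => k kc.
      by rewrite mem_undup !mem_cat kc orbT.
    by apply: sigma_measurable_coord; rewrite mem_undup !mem_cat mem_head !orbT.
  have iR : P.-integrable setT (EFin \o (fun w => W m l w * (W m' l' w * Z m' l' w))).
    apply: (le_integrable measurableT _ _ (iZ m' l')).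
      by apply/measurable_EFinP; exact: (sigma_measurableW sR).
    move=> w _; rewrite /= lee_fin !normrM mulrA ler_piMl//.
    have /andP[a0 a1] := W01 m l w; have /andP[b0 b1] := W01 m' l' w.
    by rewrite !ger0_norm// mulr_ile1.
  rewrite (indep_RintegralM noise.1 us sZ sR (iZ m l) iR).
  by rewrite (gaussian_mean0 sigma_gt0 (noise.2 c)) mul0r.
have sm := @second_moment_local_dependence _ _ _ P _ s u r _ mu u2
  (fun a b _ _ => @far a b).
under eq_set do rewrite sumE.
have mS : measurable_fun setT (fun w => \sum_(a <- s) u a w).
  exact: measurable_sum.
apply: le_trans (le_trans sm _).
  apply: lower_bound_integral.
  - exact: measurable_set_le_norm.
  - exact: sqr_ge0.
  - by move=> w; exact: sqr_ge0.
  by move=> w /= hw; rewrite -[leRHS]real_normK ?num_real// ler_sqr ?nnegrE.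
rewrite lee_fin; apply: ler_wpM2l; first by rewrite mulr_ge0 ?sqr_ge0.
rewrite ler_nat.
have inner a : (\sum_(b <- s) r a b <= (2 * delta + 1) * (delta + 1))%N.
  rewrite big_allpairs_dep/=.
  (* The relation [r] compares columns only, so each close column counts with all its [delta + 1]
     rows. *)
  rewrite (eq_bigr (fun m' => ((a.1 <= m' + delta) && (m' <= a.1 + delta)) *
      (delta + 1))%N); last first.
    by move=> m' _; rewrite /r/= sum_nat_const_nat mulnC; congr (_ * _)%N; lia.
  by rewrite -big_distrl/= leq_mul2r sum_close_le orbT.
apply: (@leq_trans (\sum_(a <- s) (2 * delta + 1) * (delta + 1))).
  exact: leq_sum.
rewrite big_const_seq count_predT iter_addn_0 /s size_allpairs !size_iota.
by rewrite subSS subn0; nia.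
Qed.

(** Markov's inequality for the sum of the [W |Z|]: the window being punctured, the weight and the
    noise of one pixel are independent, and at most [n ^ 2] pixels contribute. *)
Lemma far_noise_deviation (e q : R) : 0 <= e -> 0 <= q -> (delta < n)%N ->
  (forall m l : nat, (1 <= m <= n)%N -> (1 <= l < n - delta)%N ->
     (\int[P]_w (W m l w)%:E <= q%:E)%E) ->
  (e%:E * P [set w | (e <= `|\sum_(1 <= m < n.+1)
      \sum_(1 <= l < n - delta) W m l w * Z m l w|)%R] <=
   ((n ^ 2)%:R * q * (1 + 8 * sigma ^+ 2))%:E)%E.
Proof.
move=> e0 q0 dn Wq.
have mWZ m l : measurable_fun setT (fun w => W m l w * Z m l w).
  exact: measurable_funM.
have mn m l : measurable_fun setT (fun w => `|Z m l w|).
  exact: (measurableT_comp (@normr_measurable R setT) (@mZ m l)).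
have mWn m l : measurable_fun setT (fun w => W m l w * `|Z m l w|).
  exact: measurable_funM.
have W0 m l w : 0 <= W m l w by have /andP[] := W01 m l w.
apply: (@le_trans _ _ (\int[P]_w (\sum_(1 <= m < n.+1)
    \sum_(1 <= l < n - delta) W m l w * `|Z m l w|)%:E)%E).
  apply: lower_bound_integral => //.
  - have mS : measurable_fun setT (fun w => \sum_(1 <= m < n.+1)
        \sum_(1 <= l < n - delta) W m l w * Z m l w).
      by apply: measurable_sum => m; exact: measurable_sum.
    exact: measurable_set_le_norm.
  - by move=> w; rewrite sumr_ge0// => m _; rewrite sumr_ge0// => l _; rewrite mulr_ge0.
  move=> w /= /le_trans; apply.
  apply: le_trans (ler_norm_sum _ _ _) _; apply: ler_sum => m _.
  apply: le_trans (ler_norm_sum _ _ _) _; apply: ler_sum => l _.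
  by rewrite normrM ger0_norm.
under eq_integral do rewrite -sumEFin.
rewrite ge0_integral_sum//; last 2 first.
- by move=> m; apply/measurable_EFinP; exact: measurable_sum.
- by move=> m w _; rewrite lee_fin sumr_ge0// => l _; rewrite mulr_ge0.
have term m l : (1 <= m <= n)%N -> (1 <= l < n - delta)%N ->
    (\int[P]_w (W m l w * `|Z m l w|)%:E <= (q * (1 + 8 * sigma ^+ 2))%:E)%E.
  move=> m1 l1; pose c : int * int := (m%:Z, l%:Z).
  have us : uniq (window delta c ++ [:: c]).
    by rewrite cat_uniq window_uniq/= orbF window_center_notin.
  have sn : sigma_measurable z [:: c] (fun w => `|Z m l w|).
    apply: (measurableT_comp (@normr_measurable R setT)).
    by apply: sigma_measurable_coord; exact: mem_head.
  rewrite (indep_ge0_integralM noise.1 us (@sW m l) sn)//.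
  rewrite EFinM; apply: lee_pmul.
  - by apply: integral_ge0 => w _; rewrite lee_fin.
  - by apply: integral_ge0 => w _; rewrite lee_fin.
  - exact: Wq.
  - exact: (gaussian_integral_abs_le sigma_gt0 (noise.2 c)).
apply: (@le_trans _ _ (\sum_(1 <= m < n.+1) \sum_(1 <= l < n - delta)
    (q * (1 + 8 * sigma ^+ 2))%:E)%E).
  rewrite big_seq [leRHS]big_seq; apply: lee_sum => m; rewrite mem_index_iota => m1.
  under eq_integral do rewrite -sumEFin.
  rewrite ge0_integral_sum//; last 2 first.
  - by move=> l; apply/measurable_EFinP.
  - by move=> l w _; rewrite lee_fin mulr_ge0.
  rewrite big_seq [leRHS]big_seq; apply: lee_sum => l; rewrite mem_index_iota => l1.
  exact: term.
under eq_bigr do rewrite sumEFin.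
rewrite sumEFin lee_fin !big_const_nat !iter_addr_0 -mulrnA subSS subn0.
rewrite -[leLHS]mulr_natl -[leRHS]mulrA; apply: ler_wpM2r.
  by rewrite mulr_ge0// addr_ge0// mulr_ge0 ?sqr_ge0.
by rewrite ler_nat; nia.
Qed.

End edge_row_deviations.

(** * The risk on the edge row *)

Section risk_bound.
Context {R : realType} {d : measure_display} {T : measurableType d}.
Context (P : probability T R) (sigma t : R) (delta n : nat).
Context (z : int * int -> {RV P >-> R}).
Hypotheses (delta_gt0 : (0 < delta)%N) (delta_ltn : (delta < n)%N).

Let W (m l : nat) := edge_weight sigma t delta n z (m%:Z, l%:Z).
Let Z (m l : nat) : T -> R := z (m%:Z, l%:Z).

Let row w : R := \sum_(1 <= m < n.+1) W m n.-1 w.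
Let near w : R :=
  \sum_(1 <= m < n.+1) \sum_(n - delta <= l < n.+1) W m l w * Z m l w.
Let far w : R :=
  \sum_(1 <= m < n.+1) \sum_(1 <= l < n - delta) W m l w * Z m l w.

(** [N1] and [N0] are the white and black total weights and [x] the noise. The noise takes at most
    half of [N1] from the numerator, and [N0 <= v <= 2 * N1 / c] bounds the denominator by
    [N1 * (c + 2) / c]. *)
Lemma weighted_mean_ge (c N1 N0 x v : R) : 0 < c -> 0 < v ->
  c * v / 2 <= N1 -> 0 <= N0 <= v -> `|x| <= c * v / 4 ->
  c / (2 * (c + 2)) <= (N1 + x) / (N1 + N0).
Proof.
move=> c0 v0 N1c /andP[N00 N0v] xc.
have cv0 : 0 < c * v by rewrite mulr_gt0.
have N10 : 0 < N1 by lra.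
rewrite ler_pdivlMr; last by lra.
rewrite mulrAC ler_pdivrMr; last by lra.
have x1 : - (c * v / 4) <= x by move: xc; rewrite ler_norml => /andP[].
apply: (@le_trans _ _ (N1 / 2 * (2 * (c + 2)))).
  have : c * N0 <= c * v by rewrite ler_pM2l.
  by rewrite !mulrDr; lra.
by rewrite ler_wpM2r//; lra.
Qed.

Lemma snlm_edge_row_ge (c : R) (i : int) (w : T) : 0 < c ->
  c * n%:R / 2 <= row w -> `|near w| <= c * n%:R / 8 -> `|far w| <= c * n%:R / 8 ->
  c / (2 * (c + 2)) <= snlm sigma t delta n (pixel_avg flat_edge n)
    (observation flat_edge n z w) i n%:Z.
Proof.
move=> c0 rowc nearc farc.
have n0 : (0 < n)%N by lia.
have W01 m l : 0 <= W m l w <= 1 by exact: edge_weight01.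
have W0 m l : 0 <= W m l w by have /andP[] := W01 m l.
pose N1 := \sum_(1 <= m < n.+1) \sum_(1 <= l < n) W m l w.
pose N0 := \sum_(1 <= m < n.+1) W m n w.
rewrite /snlm.
have -> : \sum_(1 <= m < n.+1) \sum_(1 <= l < n.+1)
    snlm_weight sigma t delta (pixel_avg flat_edge n) (observation flat_edge n z w)
      i n%:Z m%:Z l%:Z = N1 + N0.
  rewrite /N1 /N0 -big_split/=; apply: eq_bigr => m _.
  rewrite big_nat_recr//=; congr (_ + _); last exact: snlm_weight_edge_row.
  by apply: eq_bigr => l _; exact: snlm_weight_edge_row.
have -> : \sum_(1 <= m < n.+1) \sum_(1 <= l < n.+1)
    snlm_weight sigma t delta (pixel_avg flat_edge n) (observation flat_edge n z w)
      i n%:Z m%:Z l%:Z * observation flat_edge n z w m%:Z l%:Z =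
    N1 + (near w + far w).
  transitivity (\sum_(1 <= m < n.+1) ((\sum_(1 <= l < n) W m l w) +
     ((\sum_(n - delta <= l < n.+1) W m l w * Z m l w) +
      (\sum_(1 <= l < n - delta) W m l w * Z m l w)))); last first.
    by rewrite big_split/= big_split.
  apply: eq_bigr => m _.
  rewrite [X in _ = _ + X]addrC -(@big_cat_nat _ _ _ (n - delta))//=; [|lia..].
  (* The white rows become a sum over all rows with the pixel value as a factor, to be merged with
     the noise term by term. *)
  have -> : \sum_(1 <= l < n) W m l w = \sum_(1 <= l < n.+1) W m l w * (l < n)%N%:R.
    rewrite big_nat_recr//= ltnn mulr0 addr0 big_nat [RHS]big_nat.
    by apply: eq_bigr => l /andP[_ ->]; rewrite mulr1.
  rewrite -big_split/=; apply: eq_bigr => l _.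
  rewrite snlm_weight_edge_row// /observation pixel_avg_flat_edge// mulrDr.
  by rewrite ltz_nat.
apply: (@weighted_mean_ge _ _ _ _ n%:R) => //.
- by rewrite ltr0n.
- apply: le_trans rowc _; apply: ler_sum => m _.
  (* For [n >= 2], row [n - 1] is among the white rows counted in [N1]. *)
  have n1 : (1 < n)%N by lia.
  rewrite -[in leRHS](prednK n0) big_nat_recr/=; last by lia.
  by rewrite lerDr sumr_ge0.
- rewrite sumr_ge0//=; apply: le_trans (ler_sum _ (fun m _ => proj2 (andP (W01 m n)))) _.
  by rewrite big_const_nat iter_addr_0 subSS subn0.
- by apply: le_trans (ler_normD _ _) _; lra.
Qed.

(** Only the errors of row [n] are kept. The true value there is 0, so on [G] each of these [n]
    squared errors is at least [kappa ^+ 2], against a normalisation by [n ^ 2]. *)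
Lemma snlm_risk_ge (kappa p : R) (G : set T) : measurable G -> 0 <= kappa ->
  (p%:E <= P G)%E ->
  (forall w i, G w -> kappa <= snlm sigma t delta n (pixel_avg flat_edge n)
    (observation flat_edge n z w) i n%:Z) ->
  ((kappa ^+ 2 / n%:R * p)%:E <= snlm_risk sigma t delta n z flat_edge)%E.
Proof.
move=> mG k0 pG Gk.
have n0 : (0 < n)%N by lia.
have n0R : 0 < n%:R :> R by rewrite ltr0n.
rewrite /snlm_risk unlock.
apply: (@le_trans _ _ ((kappa ^+ 2 / n%:R)%:E * P G)%E).
  by rewrite EFinM lee_wpmul2l// lee_fin divr_ge0 ?sqr_ge0// ltW.
apply: lower_bound_integral => //.
- by rewrite divr_ge0 ?sqr_ge0// ltW.
- move=> w; rewrite mulr_ge0 ?invr_ge0 ?exprn_ge0 ?ler0n//.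
  by rewrite sumr_ge0// => i _; rewrite sumr_ge0// => j _; exact: sqr_ge0.
move=> w Gw.
have -> : kappa ^+ 2 / n%:R = n%:R ^- 2 * (\sum_(1 <= i < n.+1) kappa ^+ 2).
  rewrite big_const_nat iter_addr_0 subSS subn0 -[_ *+ n]mulr_natr.
  by field; rewrite gt_eqF.
rewrite ler_wpM2l ?invr_ge0 ?exprn_ge0 ?ler0n//.
apply: ler_sum => i _; rewrite big_nat_recr//=.
rewrite -[leLHS]add0r lerD//.
  by rewrite sumr_ge0// => j _; exact: sqr_ge0.
rewrite pixel_avg_flat_edge// ltxx sub0r sqrrN ler_sqr ?nnegrE ?Gk//.
by apply: le_trans k0 _; exact: Gk.
Qed.

End risk_bound.

(** The cube of the window size is at most [k ^+ 3] times the power 9/10 of [n], and the remaining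
    power 1/10 eventually exceeds [k ^+ 3 / eta]. *)
Lemma cube_littleo {R : realType} (delta : nat -> nat) (beta eta : R) :
  0 < eta -> beta <= 3 / 10 ->
  (fun n => (delta n)%:R : R^o) =O_\oo (fun n => n%:R `^ beta : R^o) ->
  \forall n \near \oo, (delta n)%:R ^+ 3 <= eta * n%:R.
Proof.
move=> eta0 beta3 /eqO_exP[k /= k0 deltaO].
near=> n.
have n1 : 1 <= n%:R :> R by rewrite ler1n; near: n; exact: nbhs_infty_gt.
have n0 : 0 < n%:R :> R by exact: lt_le_trans n1.
have dk : (delta n)%:R <= k * n%:R `^ (3 / 10).
  have : `|(delta n)%:R| <= k * `|n%:R `^ beta| by near: n.
  rewrite (ger0_norm (ler0n _ _)) (ger0_norm (powR_ge0 _ _)) => /le_trans; apply.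
  by rewrite ler_wpM2l ?(ltW k0)// ler_powR.
have nk : k ^+ 3 / eta <= n%:R `^ (1 / 10).
  have q0 : 0 <= k ^+ 3 / eta by rewrite divr_ge0 ?exprn_ge0// ltW.
  have qE : k ^+ 3 / eta = ((k ^+ 3 / eta) ^+ 10) `^ (1 / 10).
    rewrite -[_ ^+ 10]powR_mulrn// -powRrM (_ : 10%:R * (1 / 10) = 1) ?powRr1//.
    by field.
  rewrite qE ge0_ler_powR ?nnegrE ?exprn_ge0//.
  by near: n; exact: nbhs_infty_ger.
apply: (@le_trans _ _ ((k * n%:R `^ (3 / 10)) ^+ 3)).
  by rewrite lerXn2r ?nnegrE// mulr_ge0 ?powR_ge0// ltW.
rewrite exprMn -[(n%:R `^ _) ^+ 3]powR_mulrn ?powR_ge0// -powRrM.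
have nE : n%:R = n%:R `^ (3 / 10 * 3%:R) * n%:R `^ (1 / 10) :> R.
  rewrite -powRD; last by rewrite gt_eqF ?implybT.
  by rewrite (_ : _ + _ = 1) ?powRr1 ?ltW//; field.
rewrite [in leRHS]nE mulrA [leRHS]mulrAC ler_wpM2r ?powR_ge0//.
by rewrite mulrC -ler_pdivrMr.
Unshelve. all: by end_near.
Qed.

(** * Combination of the three deviation bounds *)

Section probability_bound.
Context {R : realType} {d : measure_display} {T : measurableType d}.
Context (P : probability T R) (sigma t c : R) (delta n : nat).
Context (z : int * int -> {RV P >-> R}).
Hypotheses (sigma_gt0 : 0 < sigma) (t_gt0 : 0 < t) (c_gt0 : 0 < c)
  (delta_gt0 : (0 < delta)%N) (delta_ltn : (delta < n)%N)
  (noise : iid_gaussian sigma z).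

Let W (m l : nat) := edge_weight sigma t delta n z (m%:Z, l%:Z).

(** Each of the bad events [E1], [E2], [E3] has probability at most 1/8, so all three are avoided
    with probability at least 1/2. In the constant [160 * (1 + 400 * sigma ^+ 2)], the summand 1
    serves [E1] and the other one [E2]. *)
Lemma snlm_risk_flat_edge_ge :
  (forall m : nat, (c%:E <= \int[P]_w (W m n.-1 w)%:E)%E) ->
  (forall m l : nat, (1 <= m <= n)%N -> (1 <= l < n - delta)%N ->
     (\int[P]_w (W m l w)%:E <= (c / (64 * (1 + 8 * sigma ^+ 2)) / n%:R)%:E)%E) ->
  delta%:R ^+ 3 <= c ^+ 2 / (160 * (1 + 400 * sigma ^+ 2)) * n%:R ->
  (((c / (2 * (c + 2))) ^+ 2 / 2 / n%:R)%:E <=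
   snlm_risk sigma t delta n z flat_edge)%E.
Proof.
move=> rowc farq d3.
pose E1 := [set w | (\sum_(1 <= m < n.+1) W m n.-1 w < c * n%:R / 2)%R].
pose E2 := [set w | (c * n%:R / 8 <= `|\sum_(1 <= m < n.+1)
      \sum_(n - delta <= l < n.+1) W m l w * z (m%:Z, l%:Z) w|)%R].
pose E3 := [set w | (c * n%:R / 8 <= `|\sum_(1 <= m < n.+1)
      \sum_(1 <= l < n - delta) W m l w * z (m%:Z, l%:Z) w|)%R].
have n0 : (0 < n)%N by lia.
have n0R : 0 < n%:R :> R by rewrite ltr0n.
have s20 : 0 < sigma ^+ 2 by rewrite exprn_gt0.
have mW m l : measurable_fun setT (W m l) by exact: measurable_edge_weight.
have mWz m l : measurable_fun setT (fun w => W m l w * z (m%:Z, l%:Z) w).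
  exact: measurable_funM.
have mE1 : measurable E1 by apply: measurable_set_lt; exact: measurable_sum.
have mE2 : measurable E2.
  by apply: measurable_set_le_norm; apply: measurable_sum => m; exact: measurable_sum.
have mE3 : measurable E3.
  by apply: measurable_set_le_norm; apply: measurable_sum => m; exact: measurable_sum.
have fin (E : set T) : measurable E -> (fine (P E))%:E = P E.
  by move=> mE; rewrite fineK//; exact: fin_num_measure.
have d1 : 1 <= delta%:R :> R by rewrite ler1n.
move: d3; set eta := c ^+ 2 / _ => d3.
have v0 : 0 < 160 * (1 + 400 * sigma ^+ 2) by lra.
have etaE : c ^+ 2 = eta * (160 * (1 + 400 * sigma ^+ 2)).
  by rewrite /eta mulfVK ?(lt0r_neq0 v0).
have eta0 : 0 < eta by rewrite divr_gt0// exprn_gt0.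
have eN0 : 0 < eta * n%:R ^+ 2 by rewrite mulr_gt0// exprn_gt0.
have pos (E : set T) : 0 <= fine (P E) by exact: fine_ge0.
clearbody eta.
have d2 : delta%:R <= delta%:R ^+ 2 :> R by rewrite ler_eXnr.
have d23 : delta%:R ^+ 2 <= delta%:R ^+ 3 :> R by rewrite ler_weXn2l.
(* The count of dependent pairs is absorbed by [4 * delta + 1 <= 5 * delta ^ 3 <= 5 * eta * n]. *)
have P1 : fine (P E1) <= 8^-1.
  have := @row_weight_deviation _ _ _ P sigma t delta n z noise c n.-1 c_gt0 rowc.
  rewrite -/(E1) -(fin _ mE1) -EFinM lee_fin natrM natrD natrM.
  move: (fine _) (pos E1) => p p0 h.
  have : eta * n%:R ^+ 2 * (160 * p) <= eta * n%:R ^+ 2 * 20.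
    apply: (@le_trans _ _ ((c * n%:R / 2) ^+ 2 * p * 4)).
      rewrite (_ : _ * 4 = c ^+ 2 * n%:R ^+ 2 * p); last by field.
      rewrite etaE (_ : _ * _ * n%:R ^+ 2 * p = eta * n%:R ^+ 2 *
        (160 * p + 160 * (400 * (sigma ^+ 2 * p)))); last by ring.
      have sp : 0 <= sigma ^+ 2 * p by rewrite mulr_ge0 ?(ltW s20).
      by rewrite (ler_pM2l eN0); lra.
    apply: (@le_trans _ _ (n%:R * (4 * delta%:R + 1) * 4)).
      by rewrite ler_pM2r.
    rewrite (_ : eta * _ * 20 = n%:R * (5 * (eta * n%:R)) * 4); last by ring.
    by rewrite ler_pM2r// ler_pM2l//; lra.
  by rewrite ler_pM2l// => hp /=; lra.
(* Here [(2 * delta + 1) * (delta + 1) ^ 2 <= 12 * delta ^ 3 <= 12 * eta * n]; the factor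
   [sigma ^+ 2] cancels on both sides. *)
have P2 : fine (P E2) <= 8^-1.
  have e0 : 0 <= c * n%:R / 8 by rewrite divr_ge0// mulr_ge0// ltW.
  have := @near_noise_deviation _ _ _ P sigma t delta n z noise sigma_gt0 _ e0 delta_ltn.
  rewrite -/(E2) -(fin _ mE2) -EFinM lee_fin.
  rewrite (_ : (n * _ * _)%:R = n%:R * (2 * delta%:R + 1) * (delta%:R + 1) ^+ 2);
    last by rewrite natrM natrX natrM natrD natrM natrD.
  move: (fine _) (pos E2) => p p0 h.
  have : eta * n%:R ^+ 2 * sigma ^+ 2 * (160 * (400 * p)) <=
         eta * n%:R ^+ 2 * sigma ^+ 2 * (64 * 96).
    apply: (@le_trans _ _ ((c * n%:R / 8) ^+ 2 * p * 64)).
      rewrite (_ : _ * 64 = c ^+ 2 * n%:R ^+ 2 * p); last by field.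
      rewrite etaE (_ : _ * _ * n%:R ^+ 2 * p = eta * n%:R ^+ 2 *
        (160 * p + 160 * (400 * (sigma ^+ 2 * p)))); last by ring.
      rewrite -mulrA ler_pM2l//; move: (sigma ^+ 2) => x; lra.
    apply: (@le_trans _ _ (8 * sigma ^+ 2 *
        (n%:R * (2 * delta%:R + 1) * (delta%:R + 1) ^+ 2) * 64)).
      by rewrite ler_pM2r.
    rewrite (_ : _ * _ * (64 * 96) = 8 * sigma ^+ 2 * (n%:R * (12 * (eta * n%:R))) * 64);
      last by ring.
    rewrite ler_pM2r// ler_pM2l ?mulr_gt0// -mulrA ler_pM2l//.
    rewrite (_ : (2 * delta%:R + 1) * (delta%:R + 1) ^+ 2 =
      2 * delta%:R ^+ 3 + 5 * delta%:R ^+ 2 + 4 * delta%:R + 1 :> R); last by ring.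
    lra.
  by rewrite ler_pM2l ?mulr_gt0// => hp /=; lra.
(* The bound assumed on the far weights makes the right-hand side of the deviation bound exactly
   [c * n / 8] times 1/8. *)
have P3 : fine (P E3) <= 8^-1.
  have e0 : 0 <= c * n%:R / 8 by rewrite divr_ge0// mulr_ge0// ltW.
  have q0 : 0 <= c / (64 * (1 + 8 * sigma ^+ 2)) / n%:R.
    by rewrite !divr_ge0// ?mulr_ge0// ?addr_ge0// ?mulr_ge0// ltW.
  have := @far_noise_deviation _ _ _ P sigma t delta n z noise sigma_gt0 _ _ e0 q0
    delta_ltn farq.
  rewrite -/(E3) -(fin _ mE3) -EFinM lee_fin natrX.
  move: (fine _) (pos E3) => p p0.
  rewrite (_ : n%:R ^+ 2 * _ * _ = c * n%:R / 8 * 8^-1); last first.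
    by field; rewrite !gt_eqF//; lra.
  by rewrite ler_pM2l ?divr_gt0 ?mulr_gt0.
pose G := ~` (E1 `|` E2 `|` E3).
have mG : measurable G by apply: measurableC; do 2 apply: measurableU => //.
have PG : (2^-1%:E <= P G)%E.
  have : (P setT <= P G + (P E1 + P E2 + P E3))%E.
    rewrite -(setvU (E1 `|` E2 `|` E3)) -/G.
    apply: le_trans (measureU2 _ _ _) _ => //; first by do 2 apply: measurableU => //.
    rewrite leeD2l//; apply: le_trans (measureU2 _ _ _) _ => //.
      exact: measurableU.
    by rewrite leeD2r// measureU2.
  rewrite -(fin _ mG) -(fin _ mE1) -(fin _ mE2) -(fin _ mE3) -!EFinD.
  have -> : P setT = 1%:E by exact: probability_setT.
  rewrite !lee_fin; lra.
have k0 : 0 <= c / (2 * (c + 2)) by rewrite divr_ge0 ?mulr_ge0 ?addr_ge0// ltW.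
have := snlm_risk_ge delta_gt0 delta_ltn (t := t) (sigma := sigma) (z := z) mG k0 PG.
rewrite mulrAC; apply=> w i Gw.
have [g1 g2 g3] : [/\ ~ E1 w, ~ E2 w & ~ E3 w].
  by split=> Ew; apply: Gw; [left; left|left; right|right].
apply: snlm_edge_row_ge => //.
- by rewrite leNgt; apply/negP.
- by rewrite ltW// ltNge; apply/negP.
- by rewrite ltW// ltNge; apply/negP.
Qed.

End probability_bound.

(** * The lower bound for all large image sizes *)

Unset Implicit Arguments.

Theorem theorem5 (R : realType) (d : measure_display) (T : measurableType d)
    (P : probability T R) (alpha C sigma : R)
    (z : nat -> int * int -> {RV P >-> R})
    (delta : nat -> nat) (t : nat -> R)
    (alpha_gt0 : 0 < alpha) (C_gt0 : 0 < C) (sigma_gt0 : 0 < sigma)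
    (noise : forall n, iid_gaussian sigma (z n))
    (A1 : delta n @[n --> \oo] --> \oo)
    (A2 : forall n, (0 < n)%N -> 0 < t n)
    (A3 : forall f, horizon_class alpha C f -> forall eps : R, 0 < eps ->
       \forall n \near \oo, forall i j m l : nat,
         (1 <= i <= n)%N -> (1 <= j <= n)%N ->
         (1 <= m <= n)%N -> (1 <= l <= n)%N ->
         2^-1 <= nbhd_dist2 (delta n) (pixel_avg f n) (pixel_avg f n)
                   i%:Z j%:Z m%:Z l%:Z ->
         (P [set w | (snlm_weight sigma (t n) (delta n) (pixel_avg f n)
                       (observation f n (z n) w) i%:Z j%:Z m%:Z l%:Z = 1)%R]
          <= (eps * n%:R^-1)%R%:E)%E)
    (A4 : exists2 beta : R, beta <= 3 / 10 &
       (fun n => (delta n)%:R : R^o) =O_\oo (fun n => n%:R `^ beta : R^o)) :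
  ereal_bigOmega
    (fun n => ereal_sup
       [set snlm_risk sigma (t n) (delta n) n (z n) f
         | f in horizon_class alpha C])
    (fun n => n%:R^-1).
Proof.
(* [B] and [c] come from [integral_edge_weight_ge]: [c], which depends on [sigma] only, bounds below
   the probability that a pixel of row [n - 1] is kept. *)
pose B := 6 / sigma ^+ 2 + 4.
pose c := expR (- (16 * B ^+ 2)).
have s20 : 0 < sigma ^+ 2 by rewrite exprn_gt0.
have c0 : 0 < c by exact: expR_gt0.
have c1 : c <= 1.
  by rewrite /c -[leRHS]expR0 ler_expR oppr_le0 mulr_ge0 ?sqr_ge0.
pose eta := c ^+ 2 / (160 * (1 + 400 * sigma ^+ 2)).
have eta0 : 0 < eta.
  by apply: divr_gt0; [rewrite exprn_gt0|lra].
(* This yields [delta n < n] below, through [delta <= delta ^ 3 <= eta * n]. *)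
have eta1 : eta < 1.
  have c21 : c ^+ 2 <= 1 by rewrite exprn_ile1// ltW.
  by rewrite ltr_pdivrMr; lra.
pose eps := c / (64 * (1 + 8 * sigma ^+ 2)).
have eps0 : 0 < eps by rewrite divr_gt0// mulr_gt0// addr_gt0// mulr_gt0.
have edgeH : horizon_class alpha C flat_edge by exact: horizon_class_flat_edge (ltW C_gt0).
have farP := A3 _ edgeH _ eps0.
case: A4 => beta beta3 deltaO.
have cubeP := cube_littleo eta0 beta3 deltaO.
have bigP : \forall n \near \oo, B <= (delta n)%:R.
  have := A1 _ (nbhs_infty_ger B); exact.
exists ((c / (2 * (c + 2))) ^+ 2 / 2).
  by rewrite divr_gt0// exprn_gt0// divr_gt0// mulr_gt0// addr_gt0.
have : \forall n \near \oo, (((c / (2 * (c + 2))) ^+ 2 / 2 / n%:R)%:E <=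
    snlm_risk sigma (t n) (delta n) n (z n) flat_edge)%E.
  near=> n.
  have n0 : (0 < n)%N by near: n; exact: nbhs_infty_gt.
  have nE : n.-1%:Z = n%:Z - 1 by rewrite -subn1 subzn.
  have Bn : B <= (delta n)%:R by near: n.
  have cuben : (delta n)%:R ^+ 3 <= eta * n%:R by near: n.
  have d1 : (0 < delta n)%N.
    rewrite -(ltr_nat R); apply: lt_le_trans Bn.
    by rewrite addr_gt0// divr_gt0.
  have dn : (delta n < n)%N.
    rewrite -(ltr_nat R); apply: (@le_lt_trans _ _ ((delta n)%:R ^+ 3)).
      by rewrite ler_eXnr// ler1n.
    apply: le_lt_trans cuben _.
    by rewrite gtr_pMl// ltr0n.
  apply: (snlm_risk_flat_edge_ge sigma_gt0 (A2 n n0)) => //.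
    move=> m; rewrite nE.
    exact: (integral_edge_weight_ge sigma_gt0 (A2 n n0) n0 d1 (noise n) _ (erefl B)).
  move=> m l m1 l1; rewrite integral_edge_weight.
  have : forall i j m l : nat,
    (1 <= i <= n)%N -> (1 <= j <= n)%N -> (1 <= m <= n)%N -> (1 <= l <= n)%N ->
    (2^-1 : R) <= nbhd_dist2 (delta n) (pixel_avg flat_edge n) (pixel_avg flat_edge n)
                   i%:Z j%:Z m%:Z l%:Z ->
         (P [set w | (snlm_weight sigma (t n) (delta n) (pixel_avg flat_edge n)
                       (observation flat_edge n (z n) w) i%:Z j%:Z m%:Z l%:Z = 1)%R]
          <= (eps * n%:R^-1)%R%:E)%E.
    by near: n.
  move=> /(_ 1%N n m l) h.
  (* Assumption (A3) concerns pairs of pixels. The weight being the same for the whole row [n], its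
     pixel of column 1 is taken as reference. *)
  under eq_set => w do rewrite -(@snlm_weight_edge_row _ _ _ P _ _ _ _ _ n0 d1 1%N).
  apply: h.
  - by rewrite n0.
  - by rewrite n0 leqnn.
  - exact: m1.
  - by have /andP[l0 ld] := l1; rewrite l0 (leq_trans (ltnW ld))// leq_subr.
  by apply: nbhd_dist2_edge_row_ge => //; have /andP[_] := l1; rewrite ltn_subRL addnC.
move=> [N _ HN]; exists N => n Nn.
rewrite ger0_norm ?invr_ge0//.
apply: le_trans (HN n (ltnW Nn)) _.
(* The bound for the single image [flat_edge] passes to the supremum over the class. *)
apply: le_trans (lee_abs _); apply: ereal_sup_ubound.
by exists flat_edge.
Unshelve. all: by end_near.
Qed.
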